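(* Let $\epsilon=\epsilon(n)>0$ be such that $\epsilon^3 n \rightarrow \infty$ and $\epsilon=o(1)$, let $\epsilon'$ be defined as the unique positive solution to $(1-\epsilon')e^{\epsilon'} = (1+\epsilon)e^{-\epsilon}$, let $p=\frac{1+\epsilon}{n}$, and let $L_i = L_i\left(G(n,n,p)\right)$ for $i=1,2$. Then with probability $1-O\left(\left(\epsilon^3 n\right)^{-\frac{1}{6}}\right)$ we have \[ \left| \left|L_1\right|- \frac{2(\epsilon + \epsilon')}{1+\epsilon}n \right| < \frac{1}{50}n^{\frac{2}{3}} \qquad \text{and} \qquad \left| L_2 \right| \leq n^{\frac{2}{3}}. \] Furthermore, with probability $1-O\left(\left(\epsilon^3 n\right)^{-\frac{1}{6}}\right)$ we have that \[ |L_1 \cap N_1| = \left(1 \pm 2\sqrt{\epsilon}\right) |L_1 \cap N_2|. \]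
   Context: $G(n,n,p)$ is the binomial random bipartite graph with partition classes $N_1$ and $N_2$, each of size $n$, in which each edge between $N_1$ and $N_2$ is included independently with probability $p$. $L_i(G)$ denotes the $i$th largest component of a graph $G$, $|L_i|$ is its order (number of vertices), and $L_1\cap N_j$ is the set of vertices of $L_1$ lying in $N_j$. All asymptotics are as $n\to\infty$. The notation $x=(1\pm\eta)y$ means $(1-\eta)y\le x\le(1+\eta)y$. *)

(* Defs.v *)
From mathcomp Require Import all_boot all_order all_algebra.
From mathcomp Require Import reals.

Set Implicit Arguments.
Unset Strict Implicit.
Unset Printing Implicit Defensive.

Import Order.TTheory GRing.Theory Num.Theory.

Local Open Scope ring_scope.

(* The vertex set of G(n,n,p): [inl i] ranges over N_1, [inr j] over N_2. *)
Definition vertex (n : nat) : finType := ('I_n + 'I_n)%type.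

Definition N1 (n : nat) : {set vertex n} := [set inl i | i : 'I_n].
Definition N2 (n : nat) : {set vertex n} := [set inr j | j : 'I_n].

(* A bipartite graph is given by its edge set: [(i, j)] is the edge between
   [inl i] and [inr j]. *)
Definition bigraph (n : nat) : finType := {set 'I_n * 'I_n}.

Definition adj (n : nat) (G : bigraph n) : rel (vertex n) :=
  fun u v =>
    match u, v with
    | inl i, inr j => (i, j) \in G
    | inr j, inl i => (i, j) \in G
    | _, _ => false
    end.

Definition components (n : nat) (G : bigraph n) : {set {set vertex n}} :=
  equivalence_partition (connect (adj G)) [set: vertex n].

(* The i-th largest component, for i >= 1.  Ties are broken arbitrarily (by the
   enumeration of [components G]); the value is [set0] when G has fewer than i
   components. *)
Definition L (n : nat) (i : nat) (G : bigraph n) : {set vertex n} :=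
  nth set0 (sort (fun A B : {set vertex n} => (#|B| <= #|A|)%N)
                 (enum (components G))) i.-1.

(* The probability that G(n,n,p) satisfies [A].  The sum is meaningful as a
   probability for 0 <= p <= 1 only. *)
Definition Pr (R : realType) (n : nat) (p : R) (A : pred (bigraph n)) : R :=
  \sum_(G : bigraph n | A G)
    \prod_(e : 'I_n * 'I_n) (if e \in G then p else 1 - p).

(* x = (1 \pm eta) y *)
Definition within_factor (R : realType) (eta x y : R) : bool :=
  (1 - eta) * y <= x <= (1 + eta) * y.

(* Main.v *)
(* Explore the graph one vertex at a time, revealing all edges at the processed
   vertex, and starting from a fresh root of [N_1] whenever the current component
   is exhausted.  After [a] vertices of [N_1] and [b] vertices of [N_2] the
   numbers [u2], [u1] of undiscovered vertices, rescaled by [(1 - p)^a] and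
   [(1 - p)^b], are martingales (the second one up to a compensator for the
   roots), so by a maximal inequality they stay within [K], of order
   [eps n^(2/3)], of [n], except with probability [O((eps^3 n)^(-1/3))].
   On that event a component can only be completed when [a] and [b] are
   [O(n^(2/3))], with a small constant, or within such a distance of the positive
   fixed point [r = (eps + eps') / (1 + eps) n] of [x = n (1 - exp (- p x))].
   So one component has about [r] vertices on each side and the earlier ones are
   small.  What remains is subcritical, with mean component size [O(1 / eps)],
   and by Markov's inequality has no component larger than [n^(2/3)]. *)
Require Import Defs.
From mathcomp Require Import all_boot all_order all_algebra.
From mathcomp Require Import reals ring lra.

Set Implicit Arguments.
Unset Strict Implicit.
Unset Printing Implicit Defensive.

Import Order.TTheory GRing.Theory Num.Theory.

Local Open Scope ring_scope.

(** * Random edge sets *)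

Definition depends_on (E : finType) (T : Type) (D : {set E}) (f : {set E} -> T) :=
  forall G G', G :&: D = G' :&: D -> f G = f G'.

Lemma depends_onS (E : finType) (T : Type) (D D' : {set E}) (f : {set E} -> T) :
  D \subset D' -> depends_on D f -> depends_on D' f.
Proof.
move=> /setIidPr sDD' fD G G' eqG; apply: fD.
by rewrite -sDD' !setIA eqG.
Qed.

(** Conditioning on the edges seen in [Q] means multiplying by this indicator and comparing with
    [Ex (cylinder R Q H)], so that no division by the probability of a history occurs. *)
Definition cylinder (R : nzRingType) (E : finType) (Q H G : {set E}) : R := (G :&: Q == H)%:R.

Lemma depends_on_cyl (R : nzRingType) (E : finType) (Q H : {set E}) :
  depends_on Q (@cylinder R E Q H).
Proof. by move=> G G' eqG; rewrite /cylinder eqG. Qed.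

Lemma depends_on_edge (R : nzRingType) (E : finType) (e : E) (x : R) :
  depends_on [set e] (fun G : {set E} => (e \in G)%:R - x : R).
Proof.
move=> G G' /setP /(_ e); rewrite !inE eqxx !andbT.
by move=> ->.
Qed.

Lemma depends_onM (R : nzRingType) (E : finType) (D : {set E}) (f g : {set E} -> R) :
  depends_on D f -> depends_on D g -> depends_on D (fun G => f G * g G).
Proof. by move=> fD gD G G' eqG; rewrite (fD _ _ eqG) (gD _ _ eqG). Qed.

Section BernoulliSets.
Variables (R : realType) (E : finType) (p : R).
Hypothesis p01 : 0 <= p <= 1.
Implicit Types (G H Q D F : {set E}) (f g : {set E} -> R).

Definition wt G : R := \prod_e (if e \in G then p else 1 - p).

Definition Ex f : R := \sum_G wt G * f G.

Lemma wt_ge0 G : 0 <= wt G.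
Proof.
have /andP[p0 p1] := p01.
by apply: prodr_ge0 => e _; case: ifP => _; rewrite ?subr_ge0.
Qed.

Lemma Ex1 : Ex (fun=> 1) = 1.
Proof.
rewrite /Ex; under eq_bigr do rewrite mulr1.
rewrite -bigA_distr big1 // => e _; exact: subrKC.
Qed.

Lemma eq_Ex f g : f =1 g -> Ex f = Ex g.
Proof. by move=> fg; apply: eq_bigr => G _; rewrite fg. Qed.

Lemma le_Ex f g : (forall G, f G <= g G) -> Ex f <= Ex g.
Proof. by move=> fg; apply: ler_sum => G _; rewrite ler_wpM2l ?wt_ge0. Qed.

Lemma Ex_ge0 f : (forall G, 0 <= f G) -> 0 <= Ex f.
Proof. by move=> f0; apply: sumr_ge0 => G _; rewrite mulr_ge0 ?wt_ge0. Qed.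

Lemma ExZ c f : Ex (fun G => c * f G) = c * Ex f.
Proof. by rewrite /Ex big_distrr; apply: eq_bigr => G _; rewrite mulrCA. Qed.

Lemma ExD f g : Ex (fun G => f G + g G) = Ex f + Ex g.
Proof. by rewrite /Ex -big_split; apply: eq_bigr => G _; rewrite mulrDr. Qed.

Lemma Ex_sum (I : Type) (r : seq I) (P : pred I) (f : I -> {set E} -> R) :
  Ex (fun G => \sum_(i <- r | P i) f i G) = \sum_(i <- r | P i) Ex (f i).
Proof.
rewrite /Ex exchange_big; apply: eq_bigr => G _.
by rewrite big_distrr.
Qed.

(** The edge [e] is independent of [f]: sets with and without [e] are paired by adding [e], and the
    weight splits off its factor at [e]. *)
Lemma Ex_edge e D f : depends_on D f -> e \notin D ->
  Ex (fun G => (e \in G)%:R * f G) = p * Ex f.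
Proof.
move=> fD eD.
pose w0 G : R := \prod_(e' | e' != e) (if e' \in G then p else 1 - p).
pose S : R := \sum_(G : {set E} | e \notin G) w0 G * f G.
have in_e : \sum_(G : {set E} | e \in G) wt G * f G = p * S.
  rewrite (reindex_onto (fun G => e |: G) (fun G => G :\ e)); last first.
    by move=> G eG; rewrite setD1K.
  rewrite /S big_distrr; apply: eq_big => [G|G].
    rewrite setU11 /=; case: (boolP (e \in G)) => eG /=; last first.
      by rewrite setU1K ?eqxx.
    by apply/eqP => /setP /(_ e); rewrite !inE eqxx eG.
  rewrite setU11 /= => /eqP eG; rewrite mulrA; congr (_ * _).
    rewrite /wt (bigD1 e) //= setU11; congr (_ * _).
    by apply: eq_bigr => e' e'e; rewrite !inE (negPf e'e).
  apply: fD; apply/setP => x; rewrite !inE.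
  by case: eqP => [->|//]; rewrite (negPf eD) !andbF.
have out_e : \sum_(G : {set E} | e \notin G) wt G * f G = (1 - p) * S.
  rewrite /S big_distrr /=; apply: eq_bigr => G eG; rewrite mulrA; congr (_ * _).
  by rewrite /wt (bigD1 e) //= (negPf eG).
have -> : Ex f = S.
  by rewrite /Ex (bigID (fun G => e \in G)) /= in_e out_e -mulrDl addrC subrK mul1r.
rewrite -in_e /Ex (bigID (fun G => e \in G)) /= [X in _ + X]big1 ?addr0.
  by apply: eq_bigr => G ->; rewrite mul1r.
by move=> G /negPf ->; rewrite mul0r mulr0.
Qed.

Lemma Ex_center e D f : depends_on D f -> e \notin D ->
  Ex (fun G => f G * ((e \in G)%:R - p)) = 0.
Proof.
move=> fD eD.
rewrite (eq_Ex (g := fun G => (e \in G)%:R * f G + (- p) * f G)).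
  by rewrite ExD ExZ (Ex_edge fD eD) mulNr subrr.
by move=> G; rewrite mulrC mulrBl mulNr.
Qed.

(** Edges outside [D] are independent of [f] and of one another, so in the expanded square only
    [x ^+ 2] and the diagonal terms, of variance [p * (1 - p)] each, survive. *)
Lemma Ex_sqr F D f (x y : R) : depends_on D f -> [disjoint F & D] ->
  Ex (fun G => f G * (x - y * \sum_(e in F) ((e \in G)%:R - p)) ^+ 2)
  = (x ^+ 2 + y ^+ 2 * (#|F|%:R * (p * (1 - p)))) * Ex f.
Proof.
move=> fD /pred0P FD0.
have FD e : e \in F -> e \notin D.
  by move=> eF; have /= := FD0 e; rewrite eF /= => ->.
pose X e G : R := (e \in G)%:R - p.
rewrite (eq_Ex (g := fun G => x ^+ 2 * f G + ((- (2 * x * y)) *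
    \sum_(e in F) f G * X e G + y ^+ 2 *
    \sum_(e in F) \sum_(e' in F) f G * X e G * X e' G))); last first.
  move=> G; rewrite -big_distrr /= -/(X _ _).
  under [X in _ = _ + (_ + _ * X)]eq_bigr do rewrite -big_distrr /=.
  rewrite -big_distrl -big_distrr /= /X; ring.
rewrite !ExD !ExZ !Ex_sum big1 ?mulr0 ?add0r; last first.
  by move=> e eF; apply: (Ex_center fD (FD _ eF)).
rewrite mulrDl -mulrA; congr (_ + _); rewrite -mulrA; congr (_ * _).
rewrite (eq_bigr (fun=> p * (1 - p) * Ex f)).
  by rewrite sumr_const -!mulrA mulr_natl.
move=> e eF; rewrite Ex_sum (bigD1 e) //= [X in _ + X]big1 ?addr0.
  rewrite (eq_Ex (g := fun G => (1 - 2 * p) * ((e \in G)%:R * f G) + p ^+ 2 * f G)).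
    by rewrite ExD !ExZ (Ex_edge fD (FD _ eF)); ring.
  by move=> G; rewrite /X; case: (e \in G) => /=; ring.
move=> e' /andP[e'F e'e]; apply: (@Ex_center _ (D :|: [set e])).
  apply: depends_onM; first exact: depends_onS (subsetUl _ _) fD.
  apply: depends_onS (subsetUr _ _) _; exact: depends_on_edge.
by rewrite !inE negb_or FD.
Qed.

(** The tower rule: the cylinder over [Q] is split according to the edges in [Q'], and the bounds on
    the pieces are summed. *)
Lemma Ex_refine Q Q' H f g : Q \subset Q' ->
  (forall H', H' \subset Q' -> H' :&: Q = H ->
     Ex (fun G => cylinder R Q' H' G * f G) <= g H' * Ex (cylinder R Q' H')) ->
  Ex (fun G => cylinder R Q H G * f G) <= Ex (fun G => cylinder R Q H G * g (G :&: Q')).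
Proof.
move=> sQQ' bound.
have split_cyl h : Ex (fun G => cylinder R Q H G * h G)
    = \sum_H' Ex (fun G => cylinder R Q H G * (cylinder R Q' H' G * h G)).
  rewrite -Ex_sum; apply: eq_Ex => G; rewrite -big_distrr /= -big_distrl /=.
  congr (_ * _); rewrite (bigD1 (G :&: Q')) //= /cylinder eqxx big1 ?addr0 ?mul1r //.
  by move=> H' /negPf; rewrite eq_sym => ->.
rewrite !split_cyl; apply: ler_sum => H' _.
have [sH'|nsH'] := boolP (H' \subset Q'); last first.
  have cyl0 G : cylinder R Q' H' G = 0.
    rewrite /cylinder; case: eqP => // eH'.
    by move: nsH'; rewrite -eH' subsetIr.
  by apply: le_Ex => G; rewrite cyl0 !mul0r mulr0.
have cylI G : cylinder R Q H G * cylinder R Q' H' G = (H' :&: Q == H)%:R * cylinder R Q' H' G.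
  rewrite /cylinder; case: (G :&: Q' =P H') => [<-|_]; last by rewrite !mulr0.
  by rewrite -setIA (setIidPr sQQ').
rewrite (eq_Ex (g := fun G => (H' :&: Q == H)%:R * (cylinder R Q' H' G * f G))); last first.
  by move=> G; rewrite mulrA cylI mulrA.
rewrite [leRHS](eq_Ex (g := fun G => (H' :&: Q == H)%:R * (g H' * cylinder R Q' H' G))).
  rewrite !ExZ; case: eqP => [e|_]; last by rewrite !mul0r.
  by rewrite !mul1r bound.
move=> G; rewrite mulrA cylI /cylinder; case: (G :&: Q' =P H') => [->|_].
  by rewrite /= !mulr1.
by rewrite /= !(mulr0, mul0r).
Qed.

End BernoulliSets.

Arguments eq_Ex {R E p f g}.
Arguments Ex_edge {R E p e D f}.
Arguments Ex_sqr {R E p F D f}.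
Arguments Ex_refine {R E p} _ {Q Q' H f g}.

(** * Susceptibility of the subcritical graph *)

(** Each visited vertex is removed from [S], so when [u] is outside [S] the recursive calls see no
    edge at [u] and are independent of the edge just crossed. *)
Fixpoint reach (n : nat) (k : nat) (S : {set vertex n}) (u : vertex n) (G : bigraph n)
    : {set vertex n} :=
  if k is k'.+1 then
    u |: \bigcup_(v in S | adj G u v) reach k' (S :\ v) v G
  else [set u].

Lemma adjC (n : nat) (G : bigraph n) : symmetric (adj G).
Proof. by case=> i [] j. Qed.

Lemma adj_connectC (n : nat) (G : bigraph n) : connect_sym (adj G).
Proof. exact/sym_connect_sym/adjC. Qed.

Lemma reach_path (n : nat) (G : bigraph n) k (S : {set vertex n}) u s :
  (size s <= k)%N -> path (adj G) u s -> uniq s -> {subset s <= S} ->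
  last u s \in reach k S u G.
Proof.
elim: s k S u => [|v s IHs] [|k] S u //=; rewrite ?inE ?eqxx //.
rewrite ltnS => szs /andP[uv pth] /andP[vs us] sub; apply/orP; right.
apply/bigcupP; exists v; first by rewrite uv sub ?inE ?eqxx.
apply: IHs => // x xs; rewrite !inE sub ?inE ?xs ?orbT // andbT.
by apply: contraNneq vs => <-.
Qed.

Definition inner_edges (n : nat) (S : {set vertex n}) : {set 'I_n * 'I_n} :=
  [set e | (inl e.1 \in S) && (inr e.2 \in S)].

Lemma inner_edgesS (n : nat) (S S' : {set vertex n}) :
  S \subset S' -> inner_edges S \subset inner_edges S'.
Proof.
by move=> /subsetP sS; apply/subsetP => e; rewrite !inE => /andP[/sS -> /sS ->].
Qed.

Lemma adj_inner (n : nat) (S : {set vertex n}) (G G' : bigraph n) u v :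
  G :&: inner_edges S = G' :&: inner_edges S -> u \in S -> v \in S ->
  adj G u v = adj G' u v.
Proof.
move=> /setP eqG; case: u v => [i|j] [i'|j'] //= uS vS.
  by have := eqG (i, j'); rewrite !inE /= uS vS !andbT.
by have := eqG (i', j); rewrite !inE /= uS vS !andbT.
Qed.

Lemma depends_on_reach (n : nat) k S u :
  depends_on (inner_edges (u |: S)) (fun G : bigraph n => reach k S u G).
Proof.
elim: k S u => [//|k IHk] S u G G' eqG /=.
congr (_ :|: _); apply: eq_big => v.
  case: (boolP (v \in S)) => //= vS.
  by apply: (adj_inner eqG); rewrite !inE ?eqxx ?vS ?orbT.
move=> /andP[vS _]; apply: (@depends_onS _ _ _ _ _ _ (IHk _ _)) eqG.
by apply: inner_edgesS; rewrite setD1K // subsetUr.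
Qed.

Section Susceptibility.
Variables (R : realType) (n : nat) (p theta : R).
Hypotheses (p01 : 0 <= p <= 1) (theta1 : 0 <= theta < 1).
Local Notation Ex := (@Ex R _ p).

(* Revealing the neighbours of [u] gives the recursion [c <= 1 + theta c], of
   fixed point [1 / (1 - theta)]. *)
Lemma Ex_reach k (S : {set vertex n}) u (D : {set 'I_n * 'I_n}) (f : bigraph n -> R) :
  (forall G, 0 <= f G) -> depends_on D f -> [disjoint inner_edges (u |: S) & D] ->
  u \notin S ->
  p * #|[set i | inl i \in S]|%:R <= theta ->
  p * #|[set j | inr j \in S]|%:R <= theta ->
  Ex (fun G => #|reach k S u G|%:R * f G) <= (1 - theta)^-1 * Ex f.
Proof.
move=> f0 fD; have /andP[th0 th1] := theta1; have /andP[p0 _] := p01.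
have Ef0 : 0 <= Ex f by apply: Ex_ge0.
have c1 : 1 <= (1 - theta)^-1 by rewrite invr_ge1 ?unitfE; lra.
elim: k S u => [|k IHk] S u SD uS SL SR.
  rewrite (eq_Ex (g := f)) ?ler_peMl // => G; by rewrite /= cards1 mul1r.
have card_le G : #|reach k.+1 S u G|%:R <=
    1 + \sum_(v in S) (adj G u v)%:R * #|reach k (S :\ v) v G|%:R :> R.
  rewrite /= (le_trans (y := (1 + \sum_(v in S | adj G u v) #|reach k (S :\ v) v G|)%:R)) //.
    rewrite ler_nat (leq_trans (leq_card_setU _ _)) // cards1 leq_add2l.
    rewrite -big_enum_cond /= -[X in (_ <= X)%N]big_enum_cond /=.
    elim/big_rec2: _ => [|v m A _ IH]; first by rewrite cards0.
    by rewrite (leq_trans (leq_card_setU _ _)) // leq_add2l.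
  rewrite natrD lerD2l natr_sum big_mkcondr /=.
  by apply: ler_sum => v vS; case: adj; rewrite ?mul1r ?mul0r.
apply: (le_trans (y := Ex (fun G => f G + \sum_(v in S)
    (adj G u v)%:R * (#|reach k (S :\ v) v G|%:R * f G)))).
  apply: le_Ex => // G; rewrite (le_trans (ler_wpM2r (f0 G) (card_le G))) //.
  by rewrite mulrDl mul1r mulr_suml lerD2l; apply: ler_sum => v _; rewrite mulrA.
rewrite ExD Ex_sum.
have step v : v \in S -> Ex (fun G => #|reach k (S :\ v) v G|%:R * f G)
    <= (1 - theta)^-1 * Ex f.
  move=> vS; have sSv : S :\ v \subset S by rewrite subD1set.
  apply: IHk; rewrite ?inE ?eqxx //.
  - apply: disjointWl SD; apply: inner_edgesS.
    by rewrite setD1K // subsetUr.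
  - apply: le_trans SL; rewrite ler_wpM2l // ler_nat subset_leq_card //.
    by apply/subsetP => i; rewrite !inE => /andP[].
  - apply: le_trans SR; rewrite ler_wpM2l // ler_nat subset_leq_card //.
    by apply/subsetP => i; rewrite !inE => /andP[].
(* Such an [e] is incident to [u]. The recursive call sees only pairs inside [S] and [f] only pairs
   in [D], so [e] is independent of both. *)
have edge v e : v \in S -> e \in inner_edges (u |: S) -> e \notin inner_edges S ->
    Ex (fun G => (e \in G)%:R * (#|reach k (S :\ v) v G|%:R * f G))
    <= p * ((1 - theta)^-1 * Ex f).
  move=> vS eu eS.
  have eD : e \notin D by have := disjointFr SD eu => ->.
  rewrite (@Ex_edge _ _ _ _ (inner_edges S :|: D)) ?ler_wpM2l ?step //.
    apply: depends_onM; last exact: depends_onS (subsetUr _ _) fD.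
    apply: depends_onS (subsetUl _ _) _ => G G' eqG.
    rewrite (@depends_on_reach _ _ _ _ G G') //.
    by rewrite setD1K.
  by rewrite inE negb_or eS.
(* Bipartiteness confines the neighbours of [u] to [opp]; the mean number of them, [p * #|opp|], is
   the offspring mean to be compared with [theta]. *)
pose opp := [set v in S | match u, v with
  | inl _, inr _ | inr _, inl _ => true | _, _ => false end].
have sum_le : \sum_(v in S) Ex (fun G => (adj G u v)%:R * (#|reach k (S :\ v) v G|%:R * f G))
    <= #|opp|%:R * (p * ((1 - theta)^-1 * Ex f)).
  rewrite (bigID (fun v => v \in opp)) /= [X in _ + X]big1 ?addr0; last first.
    move=> v /andP[vS]; rewrite inE vS /= => nopp.
    rewrite (eq_Ex (g := fun=> 0 * 0)); first by rewrite ExZ mul0r.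
    move=> G; rewrite mulr0.
    by case: u v nopp {SD uS card_le edge opp vS} => [?|?] [?|?]; rewrite /= ?mul0r.
  rewrite -sum1_card natr_sum mulr_suml.
  rewrite [leLHS](eq_bigl (mem opp)); last first.
    by move=> v; rewrite !inE andbA andbb.
  apply: ler_sum => v; rewrite !inE mul1r => /andP[vS].
  case: u v vS @opp uS SD edge {card_le} => [i|j] [i'|j'] // vS _ uS SD edge _ /=.
    by apply: (edge _ (i, j')) => //; rewrite !inE /= ?eqxx ?vS ?orbT // (negPf uS).
  by apply: (edge _ (i', j)) => //; rewrite !inE /= ?eqxx ?vS ?orbT // (negPf uS) andbF.
have opp_le : p * #|opp|%:R <= theta.
  case: u {SD uS card_le edge sum_le} @opp => [i|j] /=.
    apply: le_trans SR; rewrite ler_wpM2l // ler_nat.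
    rewrite -(card_imset _ (@inr_inj 'I_n 'I_n)) subset_leq_card //.
    apply/subsetP => -[?|j] //; rewrite !inE ?andbF // => /andP[jS _].
    by apply/imsetP; exists j; rewrite ?inE.
  apply: le_trans SL; rewrite ler_wpM2l // ler_nat.
  rewrite -(card_imset _ (@inl_inj 'I_n 'I_n)) subset_leq_card //.
  apply/subsetP => -[i|?] //; rewrite !inE ?andbF // => /andP[iS _].
  by apply/imsetP; exists i; rewrite ?inE.
apply: (le_trans (y := Ex f + theta * ((1 - theta)^-1 * Ex f))).
  rewrite lerD2l (le_trans sum_le) // mulrA ler_wpM2r ?(mulrC _ p) //.
  by rewrite mulr_ge0 // (le_trans ler01).
rewrite le_eqVlt; apply/orP; left; apply/eqP.
have th1' : 1 - theta != 0 by rewrite subr_eq0 gt_eqF.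
by field.
Qed.

End Susceptibility.

(** * Exploration *)

Section Components.
Variable n : nat.
Implicit Types (G H : bigraph n) (A B : {set 'I_n}) (X Y : {set vertex n}).

Definition vset A B : {set vertex n} :=
  [set x | match x with inl i => i \in A | inr j => j \in B end].

Definition component G u : {set vertex n} := [set v | connect (adj G) u v].

Lemma componentsP G X :
  reflect (exists u, X = component G u) (X \in components G).
Proof.
apply: (iffP imsetP) => [[u _ ->]|[u ->]]; exists u => //.
  by apply/setP => v; rewrite !inE.
by apply/setP => v; rewrite !inE.
Qed.

Lemma vset_closed G A B :
  (forall i j, (i, j) \in G -> (i \in A) = (j \in B)) -> closed (adj G) (mem (vset A B)).
Proof. by move=> cl [i|j] [i'|j'] //= /cl e; rewrite !inE e. Qed.

Lemma component_closed G X u :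
  closed (adj G) (mem X) -> u \in X -> component G u \subset X.
Proof.
move=> clX uX; apply/subsetP => v; rewrite inE => uv.
by have /= <- := closed_connect clX uv.
Qed.

Lemma component_vset G A B u :
  closed (adj G) (mem (vset A B)) ->
  {in vset A B &, forall x y, connect (adj G) x y} ->
  u \in vset A B -> component G u = vset A B.
Proof.
move=> cl conn uAB; apply/eqP; rewrite eqEsubset component_closed //=.
by apply/subsetP => v vAB; rewrite inE conn.
Qed.

Lemma component_eq G u v : v \in component G u -> component G v = component G u.
Proof.
rewrite inE => uv; apply/setP => x; rewrite !inE.
by rewrite (same_connect (adj_connectC G) uv).
Qed.

Lemma vset_N1 A B : #|vset A B :&: N1 n| = #|A|.
Proof.
rewrite -(card_imset _ (@inl_inj 'I_n 'I_n)); apply: eq_card => -[i|j].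
  rewrite !inE imset_f ?inE // andbT (mem_imset _ _ (@inl_inj _ _)) //.
rewrite !inE; apply/andP/imsetP => [[_ /imsetP[]]|[]] //.
Qed.

Lemma vset_N2 A B : #|vset A B :&: N2 n| = #|B|.
Proof.
rewrite -(card_imset _ (@inr_inj 'I_n 'I_n)); apply: eq_card => -[i|j].
  rewrite !inE; apply/andP/imsetP => [[_ /imsetP[]]|[]] //.
rewrite !inE imset_f ?inE // andbT (mem_imset _ _ (@inr_inj _ _)) //.
Qed.

Lemma card_N12 X : #|X| = (#|X :&: N1 n| + #|X :&: N2 n|)%N.
Proof.
rewrite -(cardsID (N1 n) X); congr (_ + _)%N; apply: eq_card => -[i|j].
  rewrite !inE imset_f //=; symmetry; apply/negP => /andP[_ /imsetP[] //].
rewrite !inE imset_f // andbT.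
suff -> : (inr j \notin N1 n) by [].
by apply/negP => /imsetP[].
Qed.

Lemma card_vset A B : #|vset A B| = (#|A| + #|B|)%N.
Proof. by rewrite card_N12 vset_N1 vset_N2. Qed.

End Components.

(** * States of the exploration and their refinement by newly revealed edges *)

Section State.
Variable n : nat.
Implicit Types (G H : bigraph n) (A B : {set 'I_n}).

Definition revealed A B : {set 'I_n * 'I_n} := [set e | (e.1 \in A) || (e.2 \in B)].

Definition nbr1 B H : {set 'I_n} := [set i | [exists j in B, (i, j) \in H]].
Definition nbr2 A H : {set 'I_n} := [set j | [exists i in A, (i, j) \in H]].

(* [A], [B]: processed vertices; [H]: the edges found at them; [A0], [B0]: the
   vertices of the components completed before the current one. *)
Record state_inv A B H A0 B0 : Prop := StateInv {
  inv_revealed : H \subset revealed A B;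
  inv_nbr2 : B \subset nbr2 A H;
  inv_A0 : A0 \subset A;
  inv_B0 : B0 \subset B;
  inv_closed : forall i j, (i, j) \in H -> (i \in A0) = (j \in B0);
  inv_conn : {in vset (A :\: A0) (B :\: B0) &, forall x y, connect (adj H) x y} }.

Lemma nbr1P B H i : reflect (exists2 j, j \in B & (i, j) \in H) (i \in nbr1 B H).
Proof. by rewrite inE; exact: exists_inP. Qed.

Lemma nbr2P A H j : reflect (exists2 i, i \in A & (i, j) \in H) (j \in nbr2 A H).
Proof. by rewrite inE; exact: exists_inP. Qed.

Lemma revealedS A B A' B' :
  A \subset A' -> B \subset B' -> revealed A B \subset revealed A' B'.
Proof.
move=> /subsetP sA /subsetP sB; apply/subsetP => e; rewrite !inE.
by case/orP => [/sA ->|/sB ->]; rewrite ?orbT.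
Qed.

Section Refine.
Variables (A B A0 B0 : {set 'I_n}) (H H' : bigraph n).
Hypothesis HH' : H' :&: revealed A B = H.

Lemma refine_edge i j : (i \in A) || (j \in B) -> ((i, j) \in H') = ((i, j) \in H).
Proof. by move=> ij; rewrite -HH' !inE ij andbT. Qed.

Lemma refine_sub : {subset H <= H'}.
Proof. by move=> e; rewrite -HH' inE => /andP[]. Qed.

Lemma refine_nbr1 : nbr1 B H' = nbr1 B H.
Proof.
apply/setP => i; apply/nbr1P/nbr1P => -[j jB ij]; exists j => //.
  by rewrite -refine_edge ?jB ?orbT.
by rewrite refine_edge ?jB ?orbT.
Qed.

Lemma refine_nbr2 : nbr2 A H' = nbr2 A H.
Proof.
apply/setP => j; apply/nbr2P/nbr2P => -[i iA ij]; exists i => //.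
  by rewrite -refine_edge ?iA.
by rewrite refine_edge ?iA.
Qed.

Lemma refine_connect x y : connect (adj H) x y -> connect (adj H') x y.
Proof.
apply: connect_sub => u v uv; apply: connect1; move: uv.
by case: u v => [i|j] [i'|j'] //=; apply: refine_sub.
Qed.

(** A newly revealed edge avoids [A] and [B], hence also the completed components inside them. *)
Lemma refine_closed : A0 \subset A -> B0 \subset B ->
  (forall i j, (i, j) \in H -> (i \in A0) = (j \in B0)) ->
  forall i j, (i, j) \in H' -> (i \in A0) = (j \in B0).
Proof.
move=> /subsetP sA /subsetP sB cl i j ij.
have [r|/norP[iA jB]] := boolP ((i \in A) || (j \in B)).
  by apply: cl; rewrite -refine_edge.
by rewrite (contraNF (sA i) iA) (contraNF (sB j) jB).
Qed.

Lemma connect_add x (C : {set vertex n}) y z :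
  {in C &, forall u v, connect (adj H') u v} -> y \in C -> adj H' x y ->
  z \in x |: C -> connect (adj H') x z.
Proof.
move=> conn yC xy; rewrite !inE => /predU1P[->|zC]; first exact: connect0.
by apply: connect_trans (connect1 xy) _; apply: conn.
Qed.

Lemma conn_add x (C : {set vertex n}) y :
  {in C &, forall u v, connect (adj H') u v} -> y \in C -> adj H' x y ->
  {in x |: C &, forall u v, connect (adj H') u v}.
Proof.
move=> conn yC xy u v uC vC; apply: (@connect_trans _ _ x).
  by rewrite (adj_connectC H') (connect_add conn yC xy uC).
exact: (connect_add conn yC xy vC).
Qed.

Lemma nbr2_sub_add v : nbr2 A H \subset nbr2 (v |: A) H'.
Proof.
apply/subsetP => j /nbr2P[i iA ij]; apply/nbr2P; exists i; rewrite ?inE ?iA ?orbT //.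
exact: refine_sub.
Qed.

(** The vertex [v] joins the current component: its neighbour [j] in [B] is not in [B0], since
    closedness would then put [v] in [A0]. *)
Lemma state_inv1 v : state_inv A B H A0 B0 -> v \in nbr1 B H -> v \notin A ->
  H' \subset revealed (v |: A) B -> state_inv (v |: A) B H' A0 B0.
Proof.
case=> sH sB sA0 sB0 cl conn /nbr1P[j jB vj] vA sH'; split=> //.
- exact: subset_trans sB (nbr2_sub_add v).
- exact: subset_trans sA0 (subsetUr _ _).
- exact: refine_closed.
have vA0 : v \notin A0 by apply: contra vA; apply: (subsetP sA0).
have -> : vset ((v |: A) :\: A0) (B :\: B0) = inl v |: vset (A :\: A0) (B :\: B0).
  apply/setP => -[i|i]; rewrite !inE // (inj_eq (@inl_inj _ _)).
  by case: eqP => [->|] //; rewrite vA0.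
apply: (conn_add (y := inr j)).
- by move=> x y xC yC; apply: refine_connect; apply: conn.
- by rewrite !inE jB -(cl _ _ vj) vA0.
- exact: refine_sub.
Qed.

Lemma state_inv2 w : state_inv A B H A0 B0 -> w \in nbr2 A H -> w \notin B ->
  H' \subset revealed A (w |: B) -> state_inv A (w |: B) H' A0 B0.
Proof.
case=> sH sB sA0 sB0 cl conn wN wB sH'; have /nbr2P[i iA iw] := wN; split=> //.
- by rewrite refine_nbr2 subUset sub1set wN.
- exact: subset_trans sB0 (subsetUr _ _).
- exact: refine_closed.
have wB0 : w \notin B0 by apply: contra wB; apply: (subsetP sB0).
have -> : vset (A :\: A0) ((w |: B) :\: B0) = inr w |: vset (A :\: A0) (B :\: B0).
  apply/setP => -[k|k]; rewrite !inE // (inj_eq (@inr_inj _ _)).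
  by case: eqP => [->|] //; rewrite wB0.
apply: (conn_add (y := inl i)).
- by move=> x y xC yC; apply: refine_connect; apply: conn.
- by rewrite !inE iA (cl _ _ iw) wB0.
- exact: refine_sub.
Qed.

(** With both queues empty, every edge at a processed vertex is known and leads to a processed
    vertex, whatever the unrevealed pairs turn out to be. *)
Lemma complete_closed : H \subset revealed A B ->
  nbr1 B H \subset A -> nbr2 A H \subset B ->
  forall i j, (i, j) \in H' -> (i \in A) = (j \in B).
Proof.
move=> sH /subsetP s1 /subsetP s2 i j ij.
case: (boolP (i \in A)) => iA.
  symmetry; apply: s2; apply/nbr2P; exists i => //.
  by rewrite -refine_edge ?iA.
case: (boolP (j \in B)) => // jB.
move: iA; rewrite s1 //; apply/nbr1P; exists j => //.
by rewrite -refine_edge ?jB ?orbT.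
Qed.

Lemma state_inv_root v : state_inv A B H A0 B0 ->
  nbr1 B H \subset A -> nbr2 A H \subset B -> v \notin A ->
  H' \subset revealed (v |: A) B -> state_inv (v |: A) B H' A B.
Proof.
case=> sH sB _ _ _ _ s1 s2 vA sH'; split=> //.
- exact: subset_trans sB (nbr2_sub_add v).
- exact: subsetUr.
- exact: complete_closed.
move=> [i|i] [j|j]; rewrite !inE ?andNb //.
by move=> /andP[/negPf -> /orP[/eqP ->|//]] /andP[/negPf -> /orP[/eqP ->|//]].
Qed.

End Refine.

Lemma card_nbr2_add A H v (R : pzRingType) :
  #|~: nbr2 (v |: A) H|%:R =
  #|~: nbr2 A H|%:R - \sum_(e in [set (v, j) | j in ~: nbr2 A H]) (e \in H)%:R :> R.
Proof.
have vinj : injective (fun j : 'I_n => (v, j)) by move=> j j' [].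
rewrite big_imset /=; last by move=> ? ? _ _; apply: vinj.
have -> : ~: nbr2 (v |: A) H = ~: nbr2 A H :\: [set j | (v, j) \in H].
  apply/setP => j; rewrite in_setC in_setD in_setC [in RHS]inE -negb_or orbC; congr (~~ _).
  apply/nbr2P/orP => [[i]|].
    by rewrite in_setU1 => /predU1P[->|iA]; [right|left; apply/nbr2P; exists i].
  case=> [/nbr2P[i iA ij]|vj]; [exists i|exists v]; rewrite ?inE ?eqxx ?iA ?orbT //.
rewrite cardsD natrB ?subset_leq_card ?subsetIl //; congr (_ - _).
rewrite -sum1_card natr_sum big_mkcond [RHS]big_mkcond; apply: eq_bigr => j _.
by rewrite !inE; case: ifP => [/andP[->->]|] //; case: ifP => // _; case: (_ \in H).
Qed.

(** The set [A] is excluded along with [nbr1 B H] because a root is processed without having been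
    found as a neighbour. *)
Lemma card_nbr1_add A B H w (R : pzRingType) :
  #|~: (A :|: nbr1 (w |: B) H)|%:R =
  #|~: (A :|: nbr1 B H)|%:R
  - \sum_(e in [set (i, w) | i in ~: (A :|: nbr1 B H)]) (e \in H)%:R :> R.
Proof.
have winj : injective (fun i : 'I_n => (i, w)) by move=> j j' [].
rewrite big_imset /=; last by move=> ? ? _ _; apply: winj.
have -> : ~: (A :|: nbr1 (w |: B) H) = ~: (A :|: nbr1 B H) :\: [set i | (i, w) \in H].
  apply/setP => i.
  have -> : (i \in ~: (A :|: nbr1 B H) :\: [set i | (i, w) \in H])
     = ~~ ((i \in A) || ((i \in nbr1 B H) || ((i, w) \in H))).
    by rewrite in_setD in_setC in_setU [i \in [set _ | _]]inE -negb_or orbC orbA.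
  rewrite in_setC in_setU; congr (~~ (_ || _)).
  apply/nbr1P/orP => [[j]|].
    by rewrite in_setU1 => /predU1P[->|jB]; [right|left; apply/nbr1P; exists j].
  case=> [/nbr1P[j jB ij]|iw]; [exists j|exists w]; rewrite ?inE ?eqxx ?jB ?orbT //.
rewrite cardsD natrB ?subset_leq_card ?subsetIl //; congr (_ - _).
rewrite -sum1_card natr_sum big_mkcond [RHS]big_mkcond; apply: eq_bigr => j _.
by rewrite !inE; case: ifP => [/andP[->->]|] //; case: ifP => // _; case: (_ \in H).
Qed.

End State.

(** * The maximal inequality along the exploration *)

Definition has_giant (R : realType) (n : nat) (P : nat -> nat -> bool) (N : R)
    (G : bigraph n) : bool :=
  [exists X in components G, P #|X :&: N1 n| #|X :&: N2 n| &&
    [forall Y in components G, (Y != X) ==> (#|Y|%:R <= N)]].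

Section Exploration.
Variables (R : realType) (n : nat) (p theta K T N Rmax : R).
Variables (small large P : nat -> nat -> bool).
Let q := 1 - p.
(** Markov bound for a component larger than [N] among the unprocessed vertices: at most [2 * n]
    vertices have mean component size at most [(1 - theta)^-1], whereas such a component adds more
    than [N ^+ 2] to the sum of these sizes. *)
Let Delta := 2 * n%:R / ((1 - theta) * N ^+ 2).

Hypotheses (p0 : 0 <= p) (p1 : p < 1) (theta01 : 0 <= theta < 1).
Hypotheses (K0 : 0 < K) (N0 : 0 < N).

(** The deterministic input. Here [a], [b] count processed vertices and [d1], [d2] discovered ones,
    roots included. While both deviations are within [K], empty queues mean either a small history,
    after which one more root is affordable, or the moment to stop. *)
Hypothesis drift : forall (a b d1 d2 : nat) (Rr : R),
  (a <= d1 <= n)%N -> (b <= d2 <= n)%N ->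
  `|(n - d2)%:R / q ^+ a - n%:R| <= K -> `|(n - d1)%:R / q ^+ b + Rr - n%:R| <= K ->
  0 <= Rr <= Rmax ->
  [/\ a.+1%:R <= T, b.+1%:R <= T &
    a = d1 -> b = d2 ->
      [&& small a b, Rr + q ^- b <= Rmax & (a < n)%N] || large a b].

Hypothesis variance : forall a u : nat, a.+1%:R <= T -> (u <= n)%N ->
  (q ^- a.+1) ^+ 2 * (u%:R * (p * (1 - p))) <= 4.

Hypothesis giant : forall a0 b0 a b : nat, small a0 b0 -> large a b ->
  [/\ (a0 != a), (a0 + b0)%:R <= N & P (a - a0) (b - b0)].

Hypothesis subcritical : forall a b, large a b ->
  p * (n - a)%:R <= theta /\ p * (n - b)%:R <= theta.

Hypothesis small0 : small 0 0.
Hypothesis Rmax0 : 0 <= Rmax.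
Hypothesis T0 : 0 <= T.

Let p01 : 0 <= p <= 1. Proof. by rewrite p0 ltW. Qed.
Let q0 : 0 < q. Proof. by rewrite subr_gt0. Qed.

Local Notation Ex := (@Ex R ('I_n * 'I_n)%type p).
Local Notation cyl := (@cylinder R ('I_n * 'I_n)%type).
Let bad (G : bigraph n) : R := (~~ has_giant P N G)%:R.

(** The current component has the giant's sizes, and all earlier ones together have at most [N]
    vertices; a failure can therefore come only from an unprocessed vertex. *)
Lemma has_giant_stop (A B A0 B0 : {set 'I_n}) (H G : bigraph n) :
  state_inv A B H A0 B0 -> nbr1 B H \subset A -> nbr2 A H \subset B ->
  small #|A0| #|B0| -> large #|A| #|B| -> G :&: revealed A B = H ->
  ~~ has_giant P N G ->
  exists2 u, u \notin vset A B & N < #|component G u|%:R.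
Proof.
move=> inv s1 s2 sm la HG; have [sH _ sA0 sB0 cl conn] := inv.
have [neA le0 PX] := giant sm la.
have clG := vset_closed (complete_closed HG sH s1 s2).
have cl0 := vset_closed (refine_closed HG sA0 sB0 cl).
pose X := vset (A :\: A0) (B :\: B0).
have clX : closed (adj G) (mem X).
  apply: vset_closed => i j ij; rewrite !inE.
  by rewrite (refine_closed HG sA0 sB0 cl ij) (complete_closed HG sH s1 s2 ij).
have /set0Pn[x] : A :\: A0 != set0.
  rewrite setD_eq0; apply: contraNN neA => sAA0.
  by rewrite eqn_leq !subset_leq_card.
move=> xX; have xX' : inl x \in X by rewrite !inE in xX *.
have XE u : u \in X -> component G u = X.
  apply: component_vset => // y z yX zX.
  by apply: (refine_connect HG); apply: conn.
move=> /exists_inPn /(_ X); rewrite /bad.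
have -> : X \in components G by apply/componentsP; exists (inl x); rewrite XE.
rewrite vset_N1 vset_N2 !cardsDS // PX => /(_ isT) /=.
move=> /forall_inPn[Y /componentsP[u ->]]; rewrite negb_imply => /andP[neX].
rewrite -ltNge => big; exists u => //.
apply/negP => uAB.
have [u0|u0] := boolP (u \in vset A0 B0).
  have := component_closed cl0 u0; move/subset_leq_card; rewrite card_vset.
  by rewrite -(ler_nat R) => /le_trans /(_ le0); rewrite leNgt big.
case/negP: neX; rewrite XE //; case: u uAB u0 {big} => i; rewrite !inE;
  by move=> -> /negPf ->.
Qed.

(** Pairs between unprocessed vertices are still unrevealed, so [Ex_reach] applies there with the
    cylinder as [f], and Markov's inequality finishes. *)
Lemma Ex_stop (A B A0 B0 : {set 'I_n}) (H : bigraph n) :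
  state_inv A B H A0 B0 -> nbr1 B H \subset A -> nbr2 A H \subset B ->
  small #|A0| #|B0| -> large #|A| #|B| ->
  Ex (fun G => cyl (revealed A B) H G * bad G) <= Delta * Ex (cyl (revealed A B) H).
Proof.
move=> inv s1 s2 sm la; have [th0 th1] := andP theta01.
pose V := ~: vset A B.
(* The fuel [#|vertex n|] is enough for every simple path. *)
pose rch u (G : bigraph n) := reach #|vertex n| (V :\ u) u G.
have [tL tR] := subcritical la.
have cardC (X : {set 'I_n}) : (n - #|X|)%N = #|~: X|.
  by rewrite [in RHS]cardsCs setCK card_ord.
have cyl0 G : 0 <= cyl (revealed A B) H G by rewrite ler0n.
have bound G : cyl (revealed A B) H G * bad G <=
    N ^- 2 * \sum_(u in V) #|rch u G|%:R * cyl (revealed A B) H G.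
  rewrite -mulr_suml /cylinder; case: eqP => [HG|_]; last by rewrite mul0r !mulr0.
  rewrite mul1r mulr1 /bad; case: (boolP (has_giant P N G)) => [_|ng] /=.
    rewrite mulr_ge0 ?invr_ge0 ?exprn_ge0 ?(ltW N0) //.
    by apply: sumr_ge0 => u _; rewrite ler0n.
  have [u uV big] := has_giant_stop inv s1 s2 sm la HG ng.
  rewrite mulrC ler_pdivlMr ?exprn_gt0 // mul1r.
  have [sH _ _ _ _ _] := inv.
  have clV : closed (adj G) (mem V).
    move=> y z yz; change ((y \in V) = (z \in V)); rewrite !in_setC; congr (~~ _).
    exact: (vset_closed (complete_closed HG sH s1 s2)) yz.
  have sub v : v \in V -> component G v \subset rch v G.
    move=> vV; apply/subsetP => z; rewrite inE => /connectP[s0 pth0 ->].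
    case/shortenP: pth0 => s pth /= /andP[vs us] _.
    apply: reach_path => //.
      by rewrite -(card_uniqP us) max_card.
    move=> y ys; rewrite in_setD1; apply/andP; split.
      by apply: contraNneq vs => <-.
    apply: (subsetP (component_closed clV vV)); rewrite inE.
    by apply: (path_connect pth); rewrite inE ys orbT.
  have uV' : u \in V by rewrite inE.
  have sCV : component G u \subset V by apply: component_closed.
  (* Each of the more than [N] vertices of this component contributes its size, again more than
     [N]. *)
  apply: (@le_trans _ _ (\sum_(v in component G u) #|component G v|%:R)).
    rewrite (eq_bigr (fun=> #|component G u|%:R)).
      by rewrite sumr_const -[leRHS]mulr_natr expr2 ler_pM // ltW.
    by move=> v vC; rewrite (component_eq vC).
  rewrite [leRHS](bigID (mem (component G u))) /= -[leLHS]addr0 lerD //.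
    rewrite big_mkcond [leRHS]big_mkcond /=; apply: ler_sum => v _.
    case: ifP => vC; last by case: ifP.
    have vV := subsetP sCV _ vC; rewrite vV ler_nat.
    exact: subset_leq_card (sub _ vV).
  by apply: sumr_ge0 => v _; rewrite ler0n.
apply: (le_trans (le_Ex p01 bound)); rewrite ExZ Ex_sum.
have Ec0 : 0 <= Ex (cyl (revealed A B) H) by apply: Ex_ge0.
apply: (@le_trans _ _ (N ^- 2 * \sum_(u in V) (1 - theta)^-1 * Ex (cyl (revealed A B) H))).
  rewrite ler_wpM2l ?invr_ge0 ?exprn_ge0 ?(ltW N0) //; apply: ler_sum => u uV.
  apply: (Ex_reach p01 theta01) => //.
  - exact: depends_on_cyl.
  - rewrite setD1K //; apply/pred0P => -[i j]; rewrite /= !inE /=.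
    by case: (i \in A); case: (j \in B).
  - by rewrite !inE eqxx.
  - apply: le_trans tL; rewrite ler_wpM2l // ler_nat cardC.
    by apply/subset_leq_card/subsetP => i; rewrite !inE => /andP[].
  - apply: le_trans tR; rewrite ler_wpM2l // ler_nat cardC.
    by apply/subset_leq_card/subsetP => i; rewrite !inE => /andP[].
have cV : #|V|%:R <= 2 * n%:R :> R.
  by rewrite -natrM ler_nat (leq_trans (max_card _)) // card_sum card_ord mul2n addnn.
rewrite sumr_const -[X in _ * X]mulr_natl.
set E := Ex _ in Ec0 *; set V' := (X in X%:R * _).
have -> : N ^- 2 * (V'%:R * ((1 - theta)^-1 * E)) = V'%:R * ((1 - theta)^-1 * N ^- 2 * E).
  by ring.
rewrite /Delta (invfM (1 - theta)) -[leRHS]mulrA ler_wpM2r //.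
by rewrite !mulr_ge0 ?invr_ge0 ?subr_ge0 ?exprn_ge0 // ltW.
Qed.

(* [u2 / q ^+ a] and [u1 / q ^+ b + Rr] are martingales, whose increments have
   variance at most [4]; [T - a] and [T - b] bound the number of remaining steps.
   [Rr] compensates for the roots, which leave [u1] without being discovered. *)
Definition potential (a b : nat) (u1 u2 Rr : R) : R :=
  ((u2 / q ^+ a - n%:R) ^+ 2 + 4 * (T - a%:R)
   + ((u1 / q ^+ b + Rr - n%:R) ^+ 2 + 4 * (T - b%:R))) / K ^+ 2 + Delta.

(** The added 4 is repaid by the linear term [4 * (T - a)] or [4 * (T - b)], which drops by 4 at the
    step; the potential is thus a supermartingale. *)
Lemma Ex_potential_step (F D : {set 'I_n * 'I_n}) f x y c :
  depends_on D f -> [disjoint F & D] -> (forall G, 0 <= f G) ->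
  y ^+ 2 * (#|F|%:R * (p * (1 - p))) <= 4 ->
  Ex (fun G => f G * (((x - y * \sum_(e in F) ((e \in G)%:R - p)) ^+ 2 + c) / K ^+ 2 + Delta))
  <= ((x ^+ 2 + 4 + c) / K ^+ 2 + Delta) * Ex f.
Proof.
move=> fD FD f0 var.
rewrite (eq_Ex (g := fun G => K ^- 2 *
    (f G * (x - y * \sum_(e in F) ((e \in G)%:R - p)) ^+ 2)
    + (c / K ^+ 2 + Delta) * f G)); last by move=> G; ring.
rewrite ExD !ExZ (Ex_sqr _ _ fD FD) mulrA -mulrDl ler_wpM2r ?Ex_ge0 //.
rewrite addrA lerD2r mulrC -mulrDl ler_wpM2r ?invr_ge0 ?exprn_ge0 ?(ltW K0) //.
by rewrite lerD2r lerD2l.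
Qed.

Lemma potential_step2 (a b : nat) (f : bigraph n -> R) D (U : {set 'I_n}) u1 v Rr :
  depends_on D f -> (forall G, 0 <= f G) ->
  [disjoint [set (v, j) | j in U] & D] -> a.+1%:R <= T ->
  Ex (fun G => f G * potential a.+1 b u1
        (#|U|%:R - \sum_(e in [set (v, j) | j in U]) (e \in G)%:R) Rr)
  <= potential a b u1 #|U|%:R Rr * Ex f.
Proof.
move=> fD f0 FD aT; set F := [set _ | _ in _] in FD *.
have cF : #|F| = #|U| by rewrite card_imset // => j j' [].
pose x := #|U|%:R / q ^+ a - n%:R.
pose c := 4 * (T - a.+1%:R) + ((u1 / q ^+ b + Rr - n%:R) ^+ 2 + 4 * (T - b%:R)).
have qn0 : q != 0 by rewrite gt_eqF.
(* Since [q = 1 - p], the extra factor [q] in the denominator offsets the mean loss [p * #|U|], and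
   only the centred sum remains. *)
rewrite (eq_Ex (g := fun G => f G *
  (((x - q ^- a.+1 * \sum_(e in F) ((e \in G)%:R - p)) ^+ 2 + c) / K ^+ 2 + Delta))).
  apply: le_trans (Ex_potential_step _ _ fD FD f0 _) _.
    by rewrite cF; apply: variance => //; rewrite (leq_trans (max_card _)) ?card_ord.
  rewrite le_eqVlt; apply/orP; left; apply/eqP; congr (_ * _).
  by rewrite /potential /x /c -natr1; ring.
move=> G; congr (_ * _); rewrite /potential /c /x sumrB sumr_const cF -mulr_natr.
rewrite -!addrA; congr ((_ ^+ 2 + _) / _ + _).
have qa : q ^+ a != 0 by rewrite expf_neq0.
rewrite exprS; have -> : p = 1 - q by rewrite /q; ring.
by field; rewrite qa qn0.
Qed.

Lemma potential_step1 (a b : nat) (f : bigraph n -> R) D (U : {set 'I_n}) u2 w Rr :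
  depends_on D f -> (forall G, 0 <= f G) ->
  [disjoint [set (i, w) | i in U] & D] -> b.+1%:R <= T ->
  Ex (fun G => f G * potential a b.+1
        (#|U|%:R - \sum_(e in [set (i, w) | i in U]) (e \in G)%:R) u2 Rr)
  <= potential a b #|U|%:R u2 Rr * Ex f.
Proof.
move=> fD f0 FD bT; set F := [set _ | _ in _] in FD *.
have cF : #|F| = #|U| by rewrite card_imset // => j j' [].
pose x := #|U|%:R / q ^+ b + Rr - n%:R.
pose c := 4 * (T - b.+1%:R) + ((u2 / q ^+ a - n%:R) ^+ 2 + 4 * (T - a%:R)).
have qn0 : q != 0 by rewrite gt_eqF.
rewrite (eq_Ex (g := fun G => f G *
  (((x - q ^- b.+1 * \sum_(e in F) ((e \in G)%:R - p)) ^+ 2 + c) / K ^+ 2 + Delta))).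
  apply: le_trans (Ex_potential_step _ _ fD FD f0 _) _.
    by rewrite cF; apply: variance => //; rewrite (leq_trans (max_card _)) ?card_ord.
  rewrite le_eqVlt; apply/orP; left; apply/eqP; congr (_ * _).
  by rewrite /potential /x /c -natr1; ring.
move=> G; congr (_ * _); rewrite /potential /c /x sumrB sumr_const cF -mulr_natr.
set S := \sum_(e in F) _.
have -> : (#|U|%:R - S) / q ^+ b.+1 = #|U|%:R / q ^+ b - q ^- b.+1 * (S - p * #|U|%:R).
  have qb : q ^+ b != 0 by rewrite expf_neq0.
  rewrite exprS; have -> : p = 1 - q by rewrite /q; ring.
  by field; rewrite qb qn0.
by ring.
Qed.

(** The count [u1] excludes [v] on both sides. The lemma then serves a discovered [v], for which
    this changes nothing, as well as a root, whose removal is charged to [Rr] beforehand. *)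
Lemma process1 (A B : {set 'I_n}) (H : bigraph n) v Rr :
  v \notin A -> B \subset nbr2 A H -> #|A|.+1%:R <= T ->
  (forall H' : bigraph n, H' \subset revealed (v |: A) B -> H' :&: revealed A B = H ->
    Ex (fun G => cyl (revealed (v |: A) B) H' G * bad G) <=
    potential #|A|.+1 #|B| #|~: ((v |: A) :|: nbr1 B H')|%:R #|~: nbr2 (v |: A) H'|%:R Rr
      * Ex (cyl (revealed (v |: A) B) H')) ->
  Ex (fun G => cyl (revealed A B) H G * bad G) <=
  potential #|A| #|B| #|~: ((v |: A) :|: nbr1 B H)|%:R #|~: nbr2 A H|%:R Rr
    * Ex (cyl (revealed A B) H).
Proof.
move=> vA sB aT IH.
have sQ : revealed A B \subset revealed (v |: A) B by rewrite revealedS ?subsetUr.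
pose g (H' : {set 'I_n * 'I_n}) := potential #|A|.+1 #|B| #|~: ((v |: A) :|: nbr1 B H')|%:R
  #|~: nbr2 (v |: A) H'|%:R Rr.
apply: (le_trans (Ex_refine (g := g) p01 sQ IH)); rewrite {}/g.
rewrite (eq_Ex (g := fun G => cyl (revealed A B) H G *
   potential #|A|.+1 #|B| #|~: ((v |: A) :|: nbr1 B H)|%:R (#|~: nbr2 A H|%:R
     - \sum_(e in [set (v, j) | j in ~: nbr2 A H]) (e \in G)%:R) Rr)).
  apply: potential_step2 => //; first exact: depends_on_cyl.
  (* An undiscovered [j] is not in [B], as roots come only from [N_1]; the pair [(v, j)] is
     therefore unrevealed. *)
  apply/pred0P => -[i j] /=; apply/negP => /andP[/imsetP[j' + [-> ->]]].
  move=> /setCP nj'; rewrite in_set /= (negPf vA) => /(subsetP sB).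
  exact: nj'.
move=> G; rewrite /cylinder; case: eqP => [HG|_]; last by rewrite !mul0r.
have HG' : (G :&: revealed (v |: A) B) :&: revealed A B = H.
  by rewrite -setIA (setIidPr sQ).
rewrite (refine_nbr1 HG') card_nbr2_add (refine_nbr2 HG'); congr (_ * potential _ _ _ (_ - _) _).
apply: eq_bigr => e /imsetP[j _ ->].
by rewrite !inE /= eqxx andbT.
Qed.

Lemma process2 (A B : {set 'I_n}) (H : bigraph n) w Rr :
  w \notin B -> #|B|.+1%:R <= T ->
  (forall H' : bigraph n, H' \subset revealed A (w |: B) -> H' :&: revealed A B = H ->
    Ex (fun G => cyl (revealed A (w |: B)) H' G * bad G) <=
    potential #|A| #|B|.+1 #|~: (A :|: nbr1 (w |: B) H')|%:R #|~: nbr2 A H'|%:R Rr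
      * Ex (cyl (revealed A (w |: B)) H')) ->
  Ex (fun G => cyl (revealed A B) H G * bad G) <=
  potential #|A| #|B| #|~: (A :|: nbr1 B H)|%:R #|~: nbr2 A H|%:R Rr
    * Ex (cyl (revealed A B) H).
Proof.
move=> wB bT IH.
have sQ : revealed A B \subset revealed A (w |: B) by rewrite revealedS ?subsetUr.
pose g (H' : {set 'I_n * 'I_n}) := potential #|A| #|B|.+1 #|~: (A :|: nbr1 (w |: B) H')|%:R
  #|~: nbr2 A H'|%:R Rr.
apply: (le_trans (Ex_refine (g := g) p01 sQ IH)); rewrite {}/g.
rewrite (eq_Ex (g := fun G => cyl (revealed A B) H G *
   potential #|A| #|B|.+1 (#|~: (A :|: nbr1 B H)|%:R
     - \sum_(e in [set (i, w) | i in ~: (A :|: nbr1 B H)]) (e \in G)%:R)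
     #|~: nbr2 A H|%:R Rr)).
  apply: potential_step1 => //; first exact: depends_on_cyl.
  apply/pred0P => -[i j] /=; apply/negP => /andP[/imsetP[i' + [-> ->]]].
  move=> /setCP ni'; rewrite in_set /= (negPf wB) orbF => iA.
  by apply: ni'; rewrite in_setU iA.
move=> G; rewrite /cylinder; case: eqP => [HG|_]; last by rewrite !mul0r.
have HG' : (G :&: revealed A (w |: B)) :&: revealed A B = H.
  by rewrite -setIA (setIidPr sQ).
rewrite (refine_nbr2 HG') card_nbr1_add (refine_nbr1 HG'); congr (_ * potential _ _ (_ - _) _ _).
apply: eq_bigr => e /imsetP[j _ ->].
by rewrite !inE /= eqxx orbT andbT.
Qed.

(** The maximal inequality, by induction on the number of unprocessed vertices: the potential bounds
    the failure probability given the history. It is at least 1 once a deviation exceeds [K], at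
    least [Delta] at the stop, and does not grow in mean in between. *)
Lemma explore_bound k (A B A0 B0 : {set 'I_n}) (H : bigraph n) (Rr : R) :
  (#|~: A| + #|~: B| < k)%N ->
  state_inv A B H A0 B0 -> small #|A0| #|B0| -> 0 <= Rr <= Rmax ->
  #|A|%:R <= T -> #|B|%:R <= T ->
  Ex (fun G => cyl (revealed A B) H G * bad G) <=
  potential #|A| #|B| #|~: (A :|: nbr1 B H)|%:R #|~: nbr2 A H|%:R Rr
    * Ex (cyl (revealed A B) H).
Proof.
elim: k A B A0 B0 H Rr => // k IHk A B A0 B0 H Rr; rewrite ltnS => lek inv sm Rr01 AT BT.
have cyl0 G : 0 <= cyl (revealed A B) H G by rewrite ler0n.
have cyl1 : Ex (fun G => cyl (revealed A B) H G * bad G) <= Ex (cyl (revealed A B) H).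
  by apply: le_Ex => // G; rewrite ler_piMr // /bad; case: (~~ _).
have Ec0 : 0 <= Ex (cyl (revealed A B) H) by apply: Ex_ge0.
have K2 : 0 < K ^+ 2 by rewrite exprn_gt0.
have Delta0 : 0 <= Delta.
  by rewrite mulr_ge0 ?invr_ge0 ?mulr_ge0 ?subr_ge0 ?exprn_ge0 // ltW //; case/andP: theta01.
have AT0 : 0 <= T - #|A|%:R by rewrite subr_ge0.
have BT0 : 0 <= T - #|B|%:R by rewrite subr_ge0.
have [devK|] := boolP ((`|#|~: nbr2 A H|%:R / q ^+ #|A| - n%:R| <= K) &&
    (`|#|~: (A :|: nbr1 B H)|%:R / q ^+ #|B| + Rr - n%:R| <= K)); last first.
  have sqK (z : R) : K < `|z| -> K ^+ 2 <= z ^+ 2.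
    by move=> /ltW; rewrite -[z ^+ 2]real_normK ?num_real // ler_pXn2r ?nnegrE ?(ltW K0).
  rewrite negb_and -!ltNge => dev; apply: (le_trans cyl1).
  rewrite ler_peMl // /potential -[leLHS]addr0 lerD // ler_pdivlMr // mul1r.
  case/orP: dev => /sqK.
    have := sqr_ge0 (#|~: (A :|: nbr1 B H)|%:R / q ^+ #|B| + Rr - n%:R); lra.
  have := sqr_ge0 (#|~: nbr2 A H|%:R / q ^+ #|A| - n%:R); lra.
have {devK} [dev2 dev1] := andP devK.
have cardC (X : {set 'I_n}) : (n - #|X|)%N = #|~: X|.
  by rewrite [in RHS]cardsCs setCK card_ord.
have cardn (X : {set 'I_n}) : (#|X| <= n)%N by rewrite (leq_trans (max_card _)) ?card_ord.
have [sH sB sA0 sB0 cl conn] := inv.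
have := @drift #|A| #|B| #|A :|: nbr1 B H| #|nbr2 A H| Rr.
rewrite !cardC !cardn !andbT subset_leq_card ?subsetUl // (subset_leq_card sB).
move=> /(_ isT isT dev2 dev1 Rr01)[aT bT stop].
have ltn_card (X : {set 'I_n}) x : x \notin X -> (#|X| < n)%N.
  by rewrite -subn_gt0 cardC => xX; apply/card_gt0P; exists x; rewrite in_setC.
have dec1 v : v \notin A -> (#|~: (v |: A)| + #|~: B| < k)%N.
  move=> vA; apply: leq_trans lek; rewrite -addSn leq_add2r -!cardC cardsU1 vA.
  by rewrite add1n subnSK ?(ltn_card _ _ vA).
have dec2 w : w \notin B -> (#|~: A| + #|~: (w |: B)| < k)%N.
  move=> wB; apply: leq_trans lek; rewrite -addnS leq_add2l -!cardC cardsU1 wB.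
  by rewrite add1n subnSK ?(ltn_card _ _ wB).
have [s1|/subsetPn[v vN vA]] := boolP (nbr1 B H \subset A); last first.
  rewrite -[A :|: _](_ : (v |: A) :|: nbr1 B H = _); last first.
    by apply/setP => i; rewrite !in_setU in_set1; case: eqP => // ->; rewrite vN !orbT.
  apply: process1 => // H' sH' HH'.
  have cA : #|v |: A| = #|A|.+1 by rewrite cardsU1 vA.
  have := IHk (v |: A) B A0 B0 H' Rr; rewrite cA; apply=> //; first exact: dec1.
  exact: (state_inv1 HH').
have [s2|/subsetPn[w wN wB]] := boolP (nbr2 A H \subset B); last first.
  apply: (process2 wB bT) => H' sH' HH'.
  have cB : #|w |: B| = #|B|.+1 by rewrite cardsU1 wB.
  have := IHk A (w |: B) A0 B0 H' Rr; rewrite cB; apply=> //; first exact: dec2.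
  exact: (state_inv2 HH').
have dA : A :|: nbr1 B H = A by apply/setUidPl.
have dB : nbr2 A H = B by apply/eqP; rewrite eqEsubset s2.
have /orP[/and3P[sm' Rr' An]|la] : [&& small #|A| #|B|, Rr + q ^- #|B| <= Rmax & (#|A| < n)%N]
    || large #|A| #|B| by apply: stop; rewrite ?dA ?dB.
  have [v vA] : exists v, v \notin A.
    have : (0 < #|~: A|)%N by rewrite -cardC subn_gt0.
    by case/card_gt0P => v; rewrite in_setC; exists v.
  (* The root lowers [u1] by one, and adding [q ^- #|B|] to [Rr] compensates exactly. *)
  have -> : potential #|A| #|B| #|~: (A :|: nbr1 B H)|%:R #|~: nbr2 A H|%:R Rr =
     potential #|A| #|B| #|~: ((v |: A) :|: nbr1 B H)|%:R #|~: nbr2 A H|%:R (Rr + q ^- #|B|).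
    have -> : (v |: A) :|: nbr1 B H = v |: A by rewrite -setUA dA.
    rewrite /potential dA -!cardC cardsU1 vA add1n.
    rewrite !natrB ?cardn // ?(ltnW An) // -natr1.
    by congr ((_ + (_ ^+ 2 + _)) / _ + _); ring.
  apply: process1 => // H' sH' HH'.
  have cA : #|v |: A| = #|A|.+1 by rewrite cardsU1 vA.
  have := IHk (v |: A) B A B H' (Rr + q ^- #|B|); rewrite cA; apply=> //.
  - exact: dec1.
  - exact: (state_inv_root HH' inv).
  - rewrite Rr' andbT addr_ge0 ?invr_ge0 ?exprn_ge0 ?(ltW q0) //.
    by case/andP: Rr01.
apply: le_trans (Ex_stop inv s1 s2 sm la) _.
rewrite ler_wpM2r // /potential -[leLHS]add0r lerD2r divr_ge0 ?(ltW K2) //.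
by rewrite !addr_ge0 ?sqr_ge0 ?mulr_ge0.
Qed.

(** At the start both counts equal [n], so the squares vanish and [8 * T] remains from the linear
    terms. *)
Lemma exploration : Ex bad <= 8 * T / K ^+ 2 + Delta.
Proof.
have eH : state_inv set0 set0 (set0 : bigraph n) set0 set0.
  split; rewrite ?sub0set //; first by move=> i j; rewrite inE.
  by move=> [i|i] y; rewrite !inE.
have := @explore_bound (n + n).+1 set0 set0 set0 set0 set0 0.
rewrite !setC0 !cardsT !card_ord !cards0.
have r0 : revealed set0 set0 = set0 :> {set 'I_n * 'I_n}.
  by apply/setP => e; rewrite !inE.
have c1 G : cyl (revealed set0 set0) set0 G = 1 by rewrite /cylinder r0 setI0 eqxx.
have n1 : nbr1 set0 (set0 : bigraph n) = set0.
  by apply/setP => i; apply/nbr1P; rewrite inE => -[j]; rewrite inE.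
have n2 : nbr2 set0 (set0 : bigraph n) = set0.
  by apply/setP => i; apply/nbr2P; rewrite inE => -[j]; rewrite inE.
rewrite n1 n2 setU0 setC0 cardsT card_ord.
move=> /(_ (leqnn _) eH small0); rewrite lexx Rmax0 T0 => /(_ isT isT isT).
rewrite (eq_Ex (g := bad)) => [|G]; last by rewrite c1 mul1r.
rewrite (eq_Ex (f := cyl _ _) (g := fun=> 1)) ?Ex1 ?mulr1 // => /le_trans; apply.
rewrite /potential !expr0 !divr1 addr0 subrr expr0n /= !subr0 !add0r.
by rewrite lerD2r ler_wpM2r ?invr_ge0 ?exprn_ge0 ?(ltW K0) //; lra.
Qed.

End Exploration.

From mathcomp Require Import all_classical all_reals all_analysis.

Import Order.TTheory GRing.Theory Num.Theory.
Import numFieldNormedType.Exports.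

Local Open Scope classical_set_scope.
Local Open Scope ring_scope.

(** * The fluid limit of the exploration *)

Section DualParameter.
Variables (R : realType) (eps eps' : R).
Hypotheses (eps_gt0 : 0 < eps) (eps_small : eps <= 1 / 50) (eps'_gt0 : 0 < eps').
Hypothesis dual : (1 - eps') * expR eps' = (1 + eps) * expR (- eps).

Lemma dual_lt1 : eps' < 1.
Proof.
have e0 := eps_gt0; have es := eps_small; have e'0 := eps'_gt0.
rewrite -subr_gt0 -(pmulr_lgt0 _ (expR_gt0 eps')) dual.
by apply: mulr_gt0; rewrite ?expR_gt0 //; lra.
Qed.

(** The two sides of [dual] are compared with quadratics: the left is at least [1 - eps' ^+ 2], the
    right at most [1 - eps ^+ 2 / 5]. *)
Lemma dual_ge : eps / 3 <= eps'.
Proof.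
have e0 := eps_gt0; have es := eps_small; have e'0 := eps'_gt0.
have l1 : 1 - eps' ^+ 2 <= (1 - eps') * expR eps'.
  rewrite (_ : 1 - eps' ^+ 2 = (1 - eps') * (1 + eps')); last by ring.
  by rewrite ler_wpM2l ?expR_ge1Dx // subr_ge0 ltW ?dual_lt1.
have l2 : (1 + eps) * expR (- eps) <= 1 - eps ^+ 2 / 5.
  have e2 : 1 + eps + eps ^+ 2 / 4 <= expR eps.
    rewrite (_ : expR eps = expR (eps / 2) ^+ 2); last first.
      by rewrite -expRM_natl -mulr_natl; congr expR; field.
    have := expR_ge1Dx (eps / 2); nra.
  rewrite expRN ler_pdivrMr ?expR_gt0 //.
  apply: le_trans (ler_wpM2l _ e2); nra.
rewrite dual in l1; have := le_trans l1 l2; nra.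
Qed.

Lemma dual_le : eps' <= 2 * eps.
Proof.
have e0 := eps_gt0; have es := eps_small; have e'0 := eps'_gt0.
have lt1 := dual_lt1.
have l1 : (1 - eps') * expR eps' <= 1 - eps' ^+ 2 / 4.
  have e2 : 1 - eps' + eps' ^+ 2 / 4 <= expR (- eps').
    rewrite (_ : expR (- eps') = expR (- eps' / 2) ^+ 2); last first.
      by rewrite -expRM_natl -mulr_natl; congr expR; field.
    have := expR_ge1Dx (- eps' / 2); nra.
  rewrite -[expR eps']invrK -expRN ler_pdivrMr ?expR_gt0 //.
  apply: le_trans (ler_wpM2l _ e2); nra.
have l2 : 1 - eps ^+ 2 <= (1 + eps) * expR (- eps).
  rewrite (_ : 1 - eps ^+ 2 = (1 + eps) * (1 - eps)); last by ring.
  by rewrite ler_wpM2l ?(expR_ge1Dx (- eps)) //; lra.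
rewrite dual in l1; have := le_trans l2 l1; nra.
Qed.

Let rho := (eps + eps') / (1 + eps).

Lemma rho_mul : (1 + eps) * rho = eps + eps'.
Proof.
have e0 := eps_gt0; have es := eps_small; have e'0 := eps'_gt0.
by rewrite /rho; field; rewrite gt_eqF //; lra. Qed.

(** Here [rho] is the survival probability of a Poisson branching process of mean [1 + eps]; [dual]
    gives [expR (- (eps + eps')) = (1 - eps') / (1 + eps)], which is [1 - rho]. *)
Lemma rho_fixpoint : expR (- ((1 + eps) * rho)) = 1 - rho.
Proof.
have e0 := eps_gt0; have es := eps_small; have e'0 := eps'_gt0.
have e1 : 1 + eps != 0 by rewrite gt_eqF //; lra.
rewrite rho_mul opprD expRD.
have -> : expR (- eps) = (1 - eps') * expR eps' / (1 + eps).
  by rewrite dual mulrAC mulfV // mul1r.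
rewrite (expRN eps') /rho; field.
by rewrite e1 gt_eqF ?expR_gt0.
Qed.

Lemma rho_ge : eps / 2 <= rho.
Proof.
have e0 := eps_gt0; have es := eps_small; have e'0 := eps'_gt0.
by rewrite /rho ler_pdivlMr; nra. Qed.

Lemma rho_le : rho <= 3 * eps.
Proof.
have e0 := eps_gt0; have es := eps_small; have e'0 := eps'_gt0.
by have := dual_le; rewrite /rho ler_pdivrMr; nra. Qed.

End DualParameter.

(* The expected number of vertices discovered by processing [x] vertices of the
   other side, when [p] is small. *)
Definition fluid (R : realType) (n p x : R) : R := n * (1 - expR (- (p * x))).

(** * Concavity of the fluid limit and its drift around the fixed point *)

Section Fluid.
Variables (R : realType) (n p : R).
Hypotheses (n_gt0 : 0 < n) (p_ge0 : 0 <= p).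
Local Notation G := (fluid n p).

Lemma fluid0 : G 0 = 0.
Proof. by rewrite /fluid mulr0 oppr0 expR0 subrr mulr0. Qed.

Lemma fluid_le x y : x <= y -> G x <= G y.
Proof.
move=> xy; rewrite /fluid ler_pM2l // lerD2l lerN2 ler_expR lerN2.
by rewrite ler_wpM2l.
Qed.

Lemma fluid_lip x y : 0 <= x -> x <= y -> G y - G x <= n * p * (y - x).
Proof.
move=> x0 xy.
have e1 : expR (- (p * y)) = expR (- (p * x)) * expR (- (p * (y - x))).
  by rewrite -expRD; congr expR; ring.
have e2 : expR (- (p * x)) <= 1 by rewrite -expR0 ler_expR oppr_le0 mulr_ge0.
have e3 := expR_ge1Dx (- (p * (y - x))).
have d0 : 0 <= p * (y - x) by rewrite mulr_ge0 // subr_ge0.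
rewrite /fluid e1 -mulrBr -[n * p * _]mulrA ler_pM2l //.
have A0 := expR_ge0 (- (p * x)); move: A0 e2 e3 d0.
move: (expR (- (p * x))) (expR (- (p * (y - x)))) (p * (y - x)) => A B C; nra.
Qed.

(** The chord inequality multiplied by [z - x]; it comes from the tangent bound for [expR] at
    [y]. *)
Lemma fluid_concave x y z : x <= y -> y <= z ->
  (z - y) * G x + (y - x) * G z <= (z - x) * G y.
Proof.
move=> xy yz.
have e w : expR (- (p * w)) = expR (- (p * y)) * expR (p * (y - w)).
  by rewrite -expRD; congr expR; ring.
have ex := expR_ge1Dx (p * (y - x)).
have ez := expR_ge1Dx (p * (y - z)).
have yz0 : 0 <= z - y by rewrite subr_ge0.
have xy0 : 0 <= y - x by rewrite subr_ge0.
have := ler_wpM2l yz0 ex; have := ler_wpM2l xy0 ez.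
rewrite /fluid (e x) (e z); have := expR_ge0 (- (p * y)).
move: (expR (- (p * y))) (expR (p * (y - x))) (expR (p * (y - z))) => A B C A0 h1 h2.
have h : 0 <= n * A * ((z - y) * B + (y - x) * C - (z - x)).
  rewrite !mulr_ge0 ?(ltW n_gt0) //; move: h1 h2; nra.
move: h; nra.
Qed.

Variables (r sg : R).
Hypotheses (r_gt0 : 0 < r) (Gr : G r = r) (sg_le : sg <= r / (4 * n)).

(* With [s = exp (- p r / 2)], the fixed point equation reads [s ^+ 2 = 1 - r / n]. *)
Lemma fluid_half : sg * (r / 2) <= G (r / 2) - r / 2.
Proof.
pose s := expR (- (p * (r / 2))).
have s2 : n * (1 - s ^+ 2) = r.
  rewrite -[RHS]Gr /fluid /s -expRM_natl; congr (_ * (1 - expR _)).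
  by rewrite -mulr_natl; field.
have s0 : 0 <= s by apply: expR_ge0.
have s1 : s <= 1.
  by rewrite /s -expR0 ler_expR oppr_le0 mulr_ge0 // divr_ge0 // ltW.
rewrite /fluid -/s.
apply: (le_trans (ler_wpM2r _ sg_le)); first by rewrite divr_ge0 // ltW.
rewrite (_ : r / (4 * n) * (r / 2) = r ^+ 2 / n / 8); last by field; rewrite gt_eqF.
rewrite -s2 (_ : (n * (1 - s ^+ 2)) ^+ 2 / n = n * (1 - s ^+ 2) ^+ 2); last first.
  by field; rewrite gt_eqF.
have n0 := n_gt0.
rewrite -subr_ge0.
rewrite (_ : _ - _ = n * ((1 - s) ^+ 2 * (4 - (1 + s) ^+ 2) / 8)); last by field.
rewrite mulr_ge0 ?(ltW n0) // divr_ge0 // mulr_ge0 ?sqr_ge0 //; nra.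
Qed.

(** The chord from 0 to [r / 2] lies below the curve, so the gain at [r / 2] is inherited in
    proportion to [x]. *)
Lemma fluid_low x : 0 <= x -> x <= r / 2 -> sg * x <= G x - x.
Proof.
move=> x0 xr; have r0 := r_gt0; have h1 := fluid_half.
have := fluid_concave x0 xr; rewrite fluid0 mulr0 add0r !subr0 => h2.
rewrite -(ler_pM2l (_ : 0 < r / 2)) ?divr_gt0 //; nra.
Qed.

Lemma fluid_mid x : r / 2 <= x -> x <= r -> sg * (r - x) <= G x - x.
Proof.
move=> rx xr; have := fluid_concave rx xr; have := fluid_half; have r0 := r_gt0.
rewrite Gr => h1 h2; rewrite -(ler_pM2l (_ : 0 < r / 2)) ?divr_gt0 //; nra.
Qed.

(** Past [r] the curve lies below the extended chord through [r / 2] and [r], along which the gain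
    falls with slope at least [sg]. *)
Lemma fluid_high x : r <= x -> G x - x <= - (sg * (x - r)).
Proof.
move=> rx; have r0 := r_gt0; have r2 : r / 2 <= r by lra.
have := fluid_concave r2 rx; have := fluid_half.
rewrite Gr => h1 h2; rewrite -(ler_pM2l (_ : 0 < r / 2)) ?divr_gt0 //; nra.
Qed.

End Fluid.

(** * Confining the exploration to neighbourhoods of 0 and [r] *)

Section Walk.
Variables (R : realType) (n p r sg K a b d1 d2 qa qb Rr : R).
Local Notation G := (fluid n p).

(** The 4 allows for the exponential in place of [qa]; multiplying back by [qa <= 1] does not
    enlarge [K]. *)
Lemma walk_discovered2 : 0 < qa -> qa <= 1 ->
  `|n * qa - n * expR (- (p * a))| <= 4 -> `|(n - d2) / qa - n| <= K ->
  `|d2 - G a| <= K + 4.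
Proof.
move=> qa0 qa1; rewrite /fluid !ler_norml => /andP[l1 u1] /andP[l2 u2].
move: l2 u2; set Z := (n - d2) / qa => l2 u2.
have eZ : d2 = n - qa * Z by rewrite /Z; field; rewrite gt_eqF.
rewrite eZ; apply/andP; split; nra.
Qed.

Lemma walk_discovered1 : 0 < qb -> qb <= 1 ->
  `|n * qb - n * expR (- (p * b))| <= 4 -> `|(n - d1) / qb + Rr - n| <= K ->
  `|d1 - G b - qb * Rr| <= K + 4.
Proof.
move=> qb0 qb1; rewrite /fluid !ler_norml => /andP[l1 u1] /andP[l2 u2].
move: l2 u2; set Z := (n - d1) / qb => l2 u2.
have eZ : d1 = n - qb * Z by rewrite /Z; field; rewrite gt_eqF.
rewrite eZ; apply/andP; split; nra.
Qed.

Hypotheses (n_gt0 : 0 < n) (p_ge0 : 0 <= p) (np : n * p <= 51 / 50).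
Hypotheses (r_gt0 : 0 < r) (Gr : G r = r) (sg_gt0 : 0 < sg) (sg_le : sg <= r / (4 * n)).
Hypotheses (K_ge : 10 <= K) (a_ge0 : 0 <= a) (b_ge0 : 0 <= b).
Hypotheses (qb01 : 0 < qb <= 1) (Rr01 : 0 <= Rr <= 5 * K).
Hypotheses (h2 : `|d2 - G a| <= K + 4) (h1 : `|d1 - G b - qb * Rr| <= K + 4).

Lemma walk_bounds :
  [/\ G a - 2 * K <= d2, d2 <= G a + 2 * K, G b - 2 * K <= d1 & d1 <= G b + 7 * K].
Proof.
have /andP[q0 q1] := qb01; have /andP[R0 R1] := Rr01; have k := K_ge.
move: h1 h2; rewrite !ler_norml => /andP[l1 u1] /andP[l2 u2].
by split; nra.
Qed.

Lemma fluid_ge0 x : 0 <= x -> 0 <= G x.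
Proof.
move=> x0; have := fluid_le n_gt0 p_ge0 x0.
by rewrite fluid0.
Qed.

(** Going round both sides, [a <= G b + 7 * K] and [b <= G a + 2 * K]. Past [r], [G (G a) <= G a],
    so [a - G a] is at most [10 * K], while it is at least [sg * (a - r)]. *)
Lemma walk_range : a <= d1 -> b <= d2 ->
  sg * (a - r) <= 10 * K /\ b <= 51 / 50 * a + 2 * K.
Proof.
move=> ad bd; have [l2 u2 l1 u1] := walk_bounds; have k := K_ge; have s0 := sg_gt0.
have Ga0 := fluid_ge0 a_ge0; have np' := np; have a0 := a_ge0.
have lip : G a <= 51 / 50 * a.
  have := fluid_lip n_gt0 p_ge0 (lexx 0) a_ge0.
  rewrite fluid0 !subr0 => h; nra.
split; last lra.
have [ar|ar] := leP r a; last by nra.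
have hi := fluid_high n_gt0 p_ge0 r_gt0 Gr sg_le ar.
have g1 : G b <= G (G a + 2 * K) by apply: fluid_le => //; lra.
have g2 : G (G a + 2 * K) - G (G a) <= n * p * (2 * K).
  have := fluid_lip n_gt0 p_ge0 Ga0 (_ : G a <= G a + 2 * K).
  rewrite [G a + 2 * K - G a]addrAC subrr add0r; apply; lra.
have g3 : G (G a) <= G a by apply: fluid_le => //; nra.
nra.
Qed.

(** Monotonicity of [G] and the errors [7 * K] and [2 * K] give [9 * K]; another [2 * K] bounds
    [G a - a] by [11 * K] in absolute value, which the drift allows only near 0 or [r]. *)
Lemma walk_complete : a = d1 -> b = d2 ->
  `|a - b| <= 9 * K /\ (sg * a <= 11 * K \/ sg * `|a - r| <= 11 * K).
Proof.
move=> ad bd; have [l2 u2 l1 u1] := walk_bounds; have k := K_ge; have s0 := sg_gt0.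
have a0 := a_ge0.
rewrite -ad in l1 u1; rewrite -bd in l2 u2.
have ab : `|a - b| <= 9 * K.
  rewrite ler_norml; apply/andP.
  have [le|/ltW le] := leP a b; have := fluid_le n_gt0 p_ge0 le; by split; lra.
split=> //; move: ab; rewrite ler_norml => /andP[ab1 ab2].
have [ra|ar] := leP r a.
  right; rewrite ger0_norm ?subr_ge0 //.
  have := fluid_high n_gt0 p_ge0 r_gt0 Gr sg_le ra; lra.
have [ra2|ar2] := leP (r / 2) a.
  right; rewrite ltr0_norm ?subr_lt0 // opprB.
  have := fluid_mid n_gt0 p_ge0 r_gt0 Gr sg_le ra2 (ltW ar); lra.
left; have := fluid_low n_gt0 p_ge0 r_gt0 Gr sg_le a_ge0 (ltW ar2); lra.
Qed.

(* [Rr] counts the roots, up to a factor close to [1]: below [r] the drift is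
   nonnegative, so only the fluctuations complete components, few of them. *)
Lemma walk_roots : a = d1 -> b = d2 -> a <= r -> b <= r -> qb * Rr <= 2 * K + 8.
Proof.
move=> ad bd ar br; have s0 := sg_gt0.
have pos x : 0 <= x -> x <= r -> x <= G x.
  move=> x0 xr; have [x2|/ltW x2] := leP x (r / 2).
    have := fluid_low n_gt0 p_ge0 r_gt0 Gr sg_le x0 x2; nra.
  have := fluid_mid n_gt0 p_ge0 r_gt0 Gr sg_le x2 xr; nra.
have pa := pos _ a_ge0 ar; have pb := pos _ b_ge0 br.
move: h1 h2; rewrite -ad -bd !ler_norml => /andP[l1 u1] /andP[l2 u2]; lra.
Qed.

End Walk.

(** One factor satisfies [1 - p <= expR (- p) <= 1 - p + p ^+ 2]; as factors are at most 1, the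
    errors add up. *)
Lemma exprn_expR_approx (R : realType) (p : R) (a : nat) : 0 <= p -> p <= 1 ->
  `|(1 - p) ^+ a - expR (- (p * a%:R))| <= a%:R * p ^+ 2.
Proof.
move=> p0 p1; pose e := expR (- p).
have q0 : 0 <= 1 - p by lra.
have qe : 1 - p <= e by have := expR_ge1Dx (- p); rewrite /e; lra.
have eq : e <= 1 - p + p ^+ 2.
  have h : (1 + p) * e <= 1.
    rewrite /e expRN ler_pdivrMr ?expR_gt0 // mul1r; exact: expR_ge1Dx.
  have : 1 <= (1 + p) * (1 - p + p ^+ 2) by nra.
  move=> h'; have := le_trans h h'; rewrite ler_pM2l //; lra.
have e1 : e <= 1 by rewrite /e -expR0 ler_expR oppr_le0.
have -> : expR (- (p * a%:R)) = e ^+ a.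
  by rewrite /e -expRM_natl -mulr_natl; congr expR; ring.
suff /andP[l u] : 0 <= e ^+ a - (1 - p) ^+ a <= a%:R * p ^+ 2.
  by rewrite distrC ger0_norm.
elim: a => [|a IHa]; first by rewrite !expr0 subrr mul0r lexx.
have q1 : (1 - p) ^+ a <= 1 by rewrite exprn_ile1 //; lra.
have qa0 : 0 <= (1 - p) ^+ a by rewrite exprn_ge0.
have a0 : 0 <= a%:R :> R by rewrite ler0n.
rewrite !exprS -natr1; move: IHa q1 qa0 a0.
move: (e ^+ a) ((1 - p) ^+ a) (a%:R : R) => E Q x /andP[l u] q1 qa0 a0.
apply/andP; split; nra.
Qed.

Lemma bernoulli_ineq (R : realType) (p : R) (a : nat) : 0 <= p -> p <= 1 ->
  1 - a%:R * p <= (1 - p) ^+ a.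
Proof.
move=> p0 p1; elim: a => [|a IHa]; first by rewrite expr0 mul0r subr0.
have a0 : 0 <= a%:R :> R by rewrite ler0n.
have q0 : 0 <= 1 - p by lra.
rewrite exprS; apply: le_trans (ler_wpM2l q0 IHa); rewrite -natr1; nra.
Qed.

Section DriftArithmetic.
Variable R : realType.

Lemma le_of_scaled (sg x m K : R) : 0 < sg -> 0 <= m -> 11 * K = sg * (m * (88 / 100)) ->
  sg * x <= 11 * K -> x <= m.
Proof. by move=> sg0 m0 -> h; rewrite -(ler_pM2l sg0) (le_trans h) // ler_pM2l //; lra. Qed.

Lemma range_le (a b r m K w : R) : a <= r + m -> b <= 51 / 50 * a + 2 * K ->
  9 * K <= m / 10 -> r <= 3 * w -> 100 * m <= w -> 1 <= m ->
  a + 1 <= 6 * w /\ b + 1 <= 6 * w.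
Proof. by move=> *; split; lra. Qed.

End DriftArithmetic.

(** * Choice of constants in the supercritical regime *)

Section Supercritical.
Variables (R : realType) (n : nat) (eps eps' t : R).
Hypotheses (t_gt0 : 0 < t) (tn : t ^+ 3 = n%:R).
Hypotheses (eps_gt0 : 0 < eps) (eps_small : eps <= 1 / 50) (epst : 20 * 100 <= eps * t).
Hypotheses (eps'_gt0 : 0 < eps') (dual : (1 - eps') * expR eps' = (1 + eps) * expR (- eps)).

(** The tolerance is [m] for distances and [K] for the martingales: with drift slope [eps / 8], a
    deviation [11 * K] means a distance [88 / 100 * m]. The target [1 / 50 * N = 20 * m] leaves room
    for several such errors. *)
Variables (p r N m K : R).
Hypotheses (pE : p = (1 + eps) / n%:R) (rE : r = (eps + eps') / (1 + eps) * n%:R).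
Hypotheses (NE : N = t ^+ 2) (mE : N = 10 * 100 * m) (KE : K = eps * m / 100).

(* [t] stands for [n^(1/3)] and [N] for [n^(2/3)]. *)
Definition giant_sizes (x y : nat) : bool :=
  [&& `|(x + y)%:R - 2 * r| < 1 / 50 * N, N < (x + y)%:R &
      within_factor (2 * Num.sqrt eps) x%:R y%:R].

Let small (a b : nat) : bool :=
  [&& a%:R <= 2 * m, b%:R <= 2 * m & `|a%:R - b%:R| <= 9 * K].
Let large (a b : nat) : bool :=
  [&& `|a%:R - r| <= 2 * m, `|b%:R - r| <= 2 * m & `|a%:R - b%:R| <= 9 * K].

Lemma scale_facts : [/\ 2 <= t, 1 <= m, n%:R = t * N, 10 <= K &
  [/\ 9 * K <= m / 10, eps * n%:R / 2 <= r, r <= 3 * (eps * n%:R) & 100 * m <= eps * n%:R]].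
Proof.
have e0 := eps_gt0; have es := eps_small; have et := epst; have t0 := t_gt0.
have tt : 10 * 100 * 100 <= t by nra.
have N1 : 10 * 100 * 100 * t <= N by rewrite NE expr2 ler_wpM2r // ltW.
have m1 : 100 * t <= m by move: N1; rewrite mE; lra.
have nE : n%:R = t * N by rewrite -tn NE exprS.
have n0 : 0 <= n%:R :> R by [].
have r1 : eps / 2 * n%:R <= r by rewrite rE ler_wpM2r // (rho_ge eps_gt0 eps_small eps'_gt0).
have r2 : r <= 3 * eps * n%:R by rewrite rE ler_wpM2r // (rho_le eps_gt0 eps_small eps'_gt0 dual).
have m0 : 0 < m by lra.
have em : 20 * 100 * 100 <= eps * m.
  apply: (@le_trans _ _ (100 * (eps * t))); first by rewrite mulrC ler_wpM2l.
  by rewrite mulrCA ler_wpM2l // ltW.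
split=> //; [lra|lra|by rewrite KE; lra|].
split.
- have : eps * m <= 1 / 50 * m by rewrite ler_wpM2r // ltW.
  rewrite KE; lra.
- by move: r1; rewrite mulrAC.
- by rewrite mulrA.
rewrite nE mulrA; have : 20 * 100 * N <= eps * t * N by rewrite ler_wpM2r // mE; lra.
rewrite mE; lra.
Qed.

Lemma N_facts : [/\ 1 / 50 * N = 20 * m, 4 * m <= N & N + 10 * m <= eps * n%:R].
Proof.
have [tt m1 nE K1 [K2 r1 r2 en]] := scale_facts.
split; [by rewrite mE; field|by rewrite mE; lra|].
rewrite nE mulrA; have : 20 * 100 * N <= eps * t * N by rewrite ler_wpM2r // mE; lra.
rewrite mE; lra.
Qed.

Lemma p_facts : [/\ 0 <= p, p < 1, n%:R * p = 1 + eps & 0 < n%:R :> R].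
Proof.
have e0 := eps_gt0; have es := eps_small; have [tt m1 nE K1 [K2 r1 r2 en]] := scale_facts.
have n2 : 50 <= n%:R :> R by nra.
have n0 : 0 < n%:R :> R by lra.
split=> //.
- by rewrite pE divr_ge0 //; lra.
- by rewrite pE ltr_pdivrMr // mul1r; lra.
- by rewrite pE mulrCA mulfV ?mulr1 // gt_eqF.
Qed.

Lemma q_pow_ge a : a%:R <= 6 * (eps * n%:R) -> 3 / 4 <= (1 - p) ^+ a.
Proof.
have e0 := eps_gt0; have es := eps_small; have [p0 p1 np n0] := p_facts => aT.
apply: le_trans (bernoulli_ineq a p0 (ltW p1)).
have h : a%:R * p <= 6 * (eps * n%:R) * p by rewrite ler_wpM2r.
have e : 6 * (eps * n%:R) * p = 6 * eps * (1 + eps) by rewrite -np; ring.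
nra.
Qed.

Lemma supercritical_drift (a b d1 d2 : nat) (Rr : R) :
  (a <= d1 <= n)%N -> (b <= d2 <= n)%N ->
  `|(n - d2)%:R / (1 - p) ^+ a - n%:R| <= K ->
  `|(n - d1)%:R / (1 - p) ^+ b + Rr - n%:R| <= K ->
  0 <= Rr <= 5 * K ->
  [/\ a.+1%:R <= 6 * (eps * n%:R), b.+1%:R <= 6 * (eps * n%:R) &
    a = d1 -> b = d2 ->
      [&& small a b, Rr + (1 - p) ^- b <= 5 * K & (a < n)%N] || large a b].
Proof.
have e0 := eps_gt0; have es := eps_small; have [tt m1 nE K1 [K2 r1 r2 en]] := scale_facts.
have [p0 p1 np n0] := p_facts.
have q0 : 0 < 1 - p by lra.
have qpow0 k : 0 < (1 - p) ^+ k by rewrite exprn_gt0.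
have qpow1 k : (1 - p) ^+ k <= 1 by rewrite exprn_ile1 //; lra.
move=> /andP[ad d1n] /andP[bd d2n]; rewrite !natrB // => Z2 Z1 Rr01.
have approx k : (k <= n)%N ->
    `|n%:R * (1 - p) ^+ k - n%:R * expR (- (p * k%:R))| <= 4.
  move=> kn; rewrite -mulrBr normrM gtr0_norm //.
  apply: (le_trans (ler_wpM2l (ltW n0) (exprn_expR_approx k p0 (ltW p1)))).
  have kn' : k%:R <= n%:R :> R by rewrite ler_nat.
  have : n%:R * (k%:R * p ^+ 2) <= n%:R * (n%:R * p ^+ 2).
    by rewrite ler_wpM2l ?ler_wpM2r ?sqr_ge0 // ltW.
  have -> : n%:R * (n%:R * p ^+ 2) = (n%:R * p) ^+ 2 by ring.
  rewrite np => /le_trans; apply; nra.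
have dd2 := walk_discovered2 (qpow0 a) (qpow1 a) (approx a (leq_trans ad d1n)) Z2.
have dd1 := walk_discovered1 (qpow0 b) (qpow1 b) (approx b (leq_trans bd d2n)) Z1.
have np' : n%:R * p <= 51 / 50 by rewrite np; lra.
have en0 : 0 < eps * n%:R by rewrite mulr_gt0.
have r0 : 0 < r by lra.
have Gr : fluid n%:R p r = r.
  have -> : r = (eps + eps') / (1 + eps) * n%:R by exact: rE.
  set rho := (eps + eps') / (1 + eps).
  rewrite /fluid; have -> : p * (rho * n%:R) = (1 + eps) * rho by rewrite -np; ring.
  rewrite (rho_fixpoint eps_gt0 eps_small eps'_gt0 dual) /rho; ring.
(* This slope is [r / (4 * n)] with [r] replaced by its lower bound [eps * n / 2]. *)
pose sg := eps / 8.
have sg0 : 0 < sg by rewrite /sg; lra.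
have sgle : sg <= r / (4 * n%:R).
  by rewrite ler_pdivlMr /sg ?mulr_gt0 //; lra.
have a0 : 0 <= a%:R :> R by []. have b0 : 0 <= b%:R :> R by [].
have qb01 : 0 < (1 - p) ^+ b <= 1 by rewrite qpow0 qpow1.
have sgK : 11 * K = sg * (m * (88 / 100)) by rewrite KE /sg; field.
have ad' : a%:R <= d1%:R :> R by rewrite ler_nat.
have bd' : b%:R <= d2%:R :> R by rewrite ler_nat.
have [rg1 rg2] := walk_range n0 p0 np' r0 Gr sg0 sgle K1 a0 qb01 Rr01 dd2 dd1 ad' bd'.
have Rr0 : 0 <= Rr by case/andP: Rr01.
have enn : eps * n%:R <= 1 / 50 * n%:R by rewrite ler_wpM2r // ltW.
have m0 : 0 <= m by apply: le_trans m1.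
have aT : a%:R <= r + m.
  rewrite -lerBlDl; apply: (le_of_scaled sg0 m0 sgK); apply: (le_trans rg1).
  by rewrite ler_wpM2r ?ler_nat // (le_trans _ K1).
have [aT' bT'] := range_le aT rg2 K2 r2 en m1.
split; [by rewrite -[a.+1%:R]natr1|by rewrite -[b.+1%:R]natr1|] => ea eb.
have ea' : a%:R = d1%:R :> R by rewrite ea.
have eb' : b%:R = d2%:R :> R by rewrite eb.
have [ab range] := walk_complete n0 p0 r0 Gr sg0 sgle K1 a0 qb01 Rr01 dd2 dd1 ea' eb'.
have roots := walk_roots n0 p0 r0 Gr sg0 sgle a0 b0 dd2 dd1 ea' eb'.
have bT : b%:R <= 6 * (eps * n%:R) by apply: le_trans bT'; rewrite lerDl.
have q34 := q_pow_ge bT.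
have qi : (1 - p) ^- b <= 4 / 3.
  by rewrite -[4 / 3]invrK lef_pV2 ?posrE ?invr_gt0 ?divr_gt0 // invf_div.
have ab' := ab; rewrite ler_norml in ab'; have /andP[ab1 ab2] := ab'.
clear ad bd Z1 Z2 dd1 dd2 approx Gr sgle qb01 np' ad' bd' qpow0 qpow1 np p0 p1 nE tt Rr01
  e0 es q0 n0 d1n d2n rg1 rg2 aT aT' bT' bT ea' eb' ea eb en0 r0 a0 b0 r2.
case: range => range.
  have aN : a%:R <= m := le_of_scaled sg0 m0 sgK range.
  apply/orP; left; apply/and3P; split.
  - by apply/and3P; split=> //; lra.
  - have ar : a%:R <= r by lra.
    have br : b%:R <= r by lra.
    (* The root budget renews itself: [4 / 3 * (2 * K + 8)], plus [4 / 3] for one more root, is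
       below [5 * K] since [K >= 10]. *)
    have : 3 / 4 * Rr <= 2 * K + 8 by apply: le_trans (roots ar br); rewrite ler_wpM2r.
    lra.
  - rewrite -(ltr_nat R); lra.
apply/orP; right.
have ar : `|a%:R - r| <= m := le_of_scaled sg0 m0 sgK range.
move: ar; rewrite ler_norml => /andP[ar1 ar2].
by apply/and3P; split=> //; rewrite ler_norml; apply/andP; split; lra.
Qed.

Lemma supercritical_variance (a u : nat) : a.+1%:R <= 6 * (eps * n%:R) -> (u <= n)%N ->
  ((1 - p) ^- a.+1) ^+ 2 * (u%:R * (p * (1 - p))) <= 4.
Proof.
move=> aT un; have e0 := eps_gt0; have es := eps_small; have [p0 p1 np n0] := p_facts.
have q34 := q_pow_ge aT.
have qi : (1 - p) ^- a.+1 <= 4 / 3 by rewrite -[4 / 3]invrK lef_pV2 ?posrE //; lra.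
have qi0 : 0 <= (1 - p) ^- a.+1 by rewrite invr_ge0; lra.
have un' : u%:R <= n%:R :> R by rewrite ler_nat.
have h1 : u%:R * (p * (1 - p)) <= 1 + eps.
  rewrite -np mulrA; apply: (@le_trans _ _ (u%:R * p)); last by rewrite ler_wpM2r.
  by rewrite ler_piMr ?mulr_ge0 //; lra.
have h2 : 0 <= u%:R * (p * (1 - p)) by rewrite !mulr_ge0 //; lra.
have : ((1 - p) ^- a.+1) ^+ 2 <= (4 / 3) ^+ 2 by nra.
have : 0 <= ((1 - p) ^- a.+1) ^+ 2 by apply: sqr_ge0.
move: h1 h2; move: (_ ^+ 2) (u%:R * _) => x y h1 h2; nra.
Qed.

Lemma supercritical_giant (a0 b0 a b : nat) : small a0 b0 -> large a b ->
  [/\ (a0 != a), (a0 + b0)%:R <= N & giant_sizes (a - a0) (b - b0)].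
Proof.
have e0 := eps_gt0; have es := eps_small; have [tt m1 nE K1 [K2 r1 r2 en]] := scale_facts.
have [N50 N4 Nen] := N_facts.
move=> /and3P[s1 s2]; rewrite ler_norml => /andP[s3 s4].
move=> /and3P[]; rewrite !ler_norml => /andP[l1 l2] /andP[l3 l4] /andP[l5 l6].
have a00 : 0 <= a0%:R :> R by []. have b00 : 0 <= b0%:R :> R by [].
have aa : a0%:R < a%:R :> R by lra.
have bb : b0%:R < b%:R :> R by lra.
split.
- by apply: contraTneq aa => ->; rewrite ltxx.
- by rewrite natrD; lra.
rewrite /giant_sizes !natrD !natrB ?ltW // -1?(ler_nat R) ?(ltW aa) ?(ltW bb) // N50.
(* The two sides of the giant differ by at most [18 * K], a small multiple of [eps * m], and each
   has at least [m] vertices; [eps <= sqrt eps] then gives the balance. *)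
have sq : eps <= Num.sqrt eps.
  rewrite -{1}(sqr_sqrtr (ltW e0)) expr2 ler_piMr ?sqrtr_ge0 //.
  by rewrite -sqrtr1 ler_wsqrtr //; lra.
apply/and3P; split.
- rewrite ltr_norml; apply/andP; split; lra.
- lra.
have y0 : m <= b%:R - b0%:R :> R by lra.
have h : 18 * K <= 2 * Num.sqrt eps * (b%:R - b0%:R).
  apply: (@le_trans _ _ (2 * eps * (b%:R - b0%:R))); last first.
    by rewrite ler_wpM2r ?ler_wpM2l //; lra.
  rewrite KE; nra.
rewrite /within_factor mulrBl mulrDl !mul1r; apply/andP; split; lra.
Qed.

(** Since [p * r = eps + eps'], removing about [r] vertices lowers the mean degree from [1 + eps] to
    about [1 - eps']; the bound [eps' >= eps / 3] absorbs the error [2 * (p * m)]. *)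
Lemma supercritical_subcritical (a b : nat) : large a b ->
  p * (n - a)%:R <= 1 - eps / 6 /\ p * (n - b)%:R <= 1 - eps / 6.
Proof.
have e0 := eps_gt0; have es := eps_small; have [tt m1 nE K1 [K2 r1 r2 en]] := scale_facts.
have [p0 p1 np n0] := p_facts; have et := epst.
have eps'_ge := dual_ge eps_gt0 eps_small eps'_gt0 dual.
have pr : p * r = eps + eps'.
  by rewrite -(rho_mul eps_gt0 eps_small eps'_gt0) rE mulrCA mulrC -np [p * _]mulrC np mulrC.
have pm : p * m <= eps / 50.
  have : n%:R * (p * m) <= n%:R * (eps / 50) by rewrite mulrA np; nra.
  by rewrite ler_pM2l.
suff gen (k : nat) : `|k%:R - r| <= 2 * m -> p * (n - k)%:R <= 1 - eps / 6.
  by case/and3P=> l1 l2 _; split; apply: gen.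
rewrite ler_norml => /andP[l1 l2].
have [kn|/ltnW nk] := leqP k n; last by rewrite (eqP nk) mulr0; lra.
rewrite natrB //; have : p * (n%:R - k%:R) <= p * (n%:R - r + 2 * m).
  by rewrite ler_wpM2l //; lra.
have -> : p * (n%:R - r + 2 * m) = n%:R * p - p * r + 2 * (p * m) by ring.
rewrite np pr; lra.
Qed.

(** The martingale part is [48 * (eps * n) / K ^+ 2], the Markov part [12 * n / (eps * N ^+ 2)];
    with [n = t ^+ 3] and [N = t ^+ 2] both are multiples of [1 / (eps * t)]. *)
Theorem supercritical_bound :
  Ex p (fun G : bigraph n => (~~ has_giant giant_sizes N G)%:R)
  <= (48 * (10 * 100 * 100) ^+ 2 + 12) / (eps * t).
Proof.
have e0 := eps_gt0; have es := eps_small; have [tt m1 nE K1 [K2 r1 r2 en]] := scale_facts.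
have [p0 p1 np n0] := p_facts; have et := epst; have t0 := t_gt0.
have N0 : 0 < N by rewrite mE; lra. have K0 : 0 < K by lra.
have th : 0 <= 1 - eps / 6 < 1 by apply/andP; split; lra.
have sm0 : small 0 0.
  by rewrite /small subrr normr0; apply/and3P; split; lra.
have R0 : 0 <= 5 * K by lra.
have T0 : 0 <= 6 * (eps * n%:R) by rewrite !mulr_ge0 // ltW.
apply: (le_trans (exploration p0 p1 th K0 N0 supercritical_drift supercritical_variance
  supercritical_giant supercritical_subcritical sm0 R0 T0)).
rewrite le_eqVlt; apply/orP; left; apply/eqP.
rewrite KE (_ : m = N / (10 * 100)); last by rewrite mE; field.
by rewrite nE NE; field; rewrite !gt_eqF.
Qed.

End Supercritical.

(** * Conclusion *)

(** Ties are harmless: only [X] exceeds [N], so every sort puts it first. *)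
Lemma has_giant_L (R : realType) (n : nat) (P : nat -> nat -> bool) (N : R) (G : bigraph n) :
  0 <= N -> (forall x y, P x y -> N < (x + y)%:R) -> has_giant P N G ->
  P #|L 1 G :&: N1 n| #|L 1 G :&: N2 n| /\ #|L 2 G|%:R <= N.
Proof.
move=> N0 PN /exists_inP[X XG /andP[PX /forall_inP small]].
have NX : N < #|X|%:R by rewrite card_N12; exact: PN.
pose geq (A B : {set vertex n}) := (#|B| <= #|A|)%N.
pose s := sort geq (enum (components G)).
have s_sorted : sorted geq s by apply: sort_sorted => A B; apply: leq_total.
have mem_s Y : (Y \in s) = (Y \in components G) by rewrite mem_sort mem_enum.
have s_uniq : uniq s by rewrite sort_uniq enum_uniq.
have X0 : nth finset.set0 s 0 = X.
  have Xs : X \in s by rewrite mem_s.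
  case es : s Xs => [//|Y s'] Xs /=; apply/eqP; apply: contraLR NX => YX.
  have YG : Y \in components G by rewrite -mem_s es inE eqxx.
  rewrite -leNgt; apply: le_trans (implyP (small _ YG) YX); rewrite ler_nat.
  move: Xs; rewrite inE => /predU1P[XY|Xs']; first by rewrite XY.
  move: s_sorted; rewrite es /= (path_sortedE (leT := geq)); last first.
    by move=> B A D AB BD; apply: leq_trans BD AB.
  by case/andP=> /allP /(_ _ Xs').
have -> : L 1 G = X by rewrite -X0.
split=> //; have -> : L 2 G = nth finset.set0 s 1 by [].
(* If [X] is the only component, [L 2 G] is the default empty set. *)
have [s1|s1] := leqP (size s) 1; first by rewrite nth_default ?cards0.
have YG : nth finset.set0 s 1 \in components G by rewrite -mem_s mem_nth.
apply: (implyP (small _ YG)); rewrite -X0 nth_uniq //.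
exact: ltnW.
Qed.

Lemma PrC (R : realType) (n : nat) (p : R) (A : pred (bigraph n)) :
  1 - Pr p A = Ex p (fun G : bigraph n => (~~ A G)%:R).
Proof.
have PrE : Pr p A = Ex p (fun G : bigraph n => (A G)%:R).
  rewrite /Pr /Ex big_mkcond; apply: eq_bigr => G _.
  by case: (A G); rewrite /= ?mulr1 ?mulr0.
apply/eqP; rewrite PrE subr_eq eq_sym -ExD -[X in _ == X](@Ex1 R ('I_n * 'I_n)%type p); apply/eqP.
by apply: eq_Ex => G; case: (A G); rewrite /= ?addr0 ?add0r.
Qed.

(** The exploration yields exponent [1 / 3], which implies the weaker [1 / 6] because [x] is
    eventually at least 1. *)
Lemma bigO_of_bound (R : realType) (u x : nat -> R) (C : R) :
  (\forall n \near \oo, 1 <= x n) ->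
  (\forall n \near \oo, 0 <= u n <= C * x n `^ (- (1 / 3))) ->
  (u : nat -> R^o) =O_\oo (fun n => x n `^ (- (1 / 6)) : R^o).
Proof.
move=> x1 ux; apply/eqO_exP; exists (`|C| + 1); first by rewrite ltr_wpDl.
near=> n.
have xn : 1 <= x n by near: n.
have /andP[u0 un] : 0 <= u n <= C * x n `^ (- (1 / 3)) by near: n.
rewrite /= [X in X <= _](ger0_norm u0) [X in _ * X](ger0_norm (powR_ge0 _ _)).
apply: (le_trans un).
apply: (@le_trans _ _ (`|C| * x n `^ (- (1 / 3)))).
  by rewrite ler_wpM2r ?powR_ge0 ?ler_norm.
rewrite ler_pM ?powR_ge0 ?lerDl //.
by rewrite ler_powR //; lra.
Unshelve. all: by end_near.
Qed.

Theorem theorem1p5 (R : realType) (eps eps' : nat -> R)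
  (eps_gt0 : forall n, 0 < eps n)
  (eps3n : eps n ^+ 3 * n%:R @[n --> \oo] --> +oo)
  (eps_o1 : eps n @[n --> \oo] --> (0 : R))
  (eps'_def : forall n,
     0 < eps' n /\
     (1 - eps' n) * expR (eps' n) = (1 + eps n) * expR (- eps n)) :
  let p (n : nat) : R := (1 + eps n) / n%:R in
  ((fun n : nat => 1 - Pr (p n) (fun G : bigraph n =>
      (`| #|L 1 G|%:R - 2 * (eps n + eps' n) / (1 + eps n) * n%:R |
         < 1 / 50 * n%:R `^ (2 / 3))
      && (#|L 2 G|%:R <= n%:R `^ (2 / 3) :> R)) : R^o)
    =O_\oo (fun n : nat => (eps n ^+ 3 * n%:R) `^ (- (1 / 6)) : R^o))
  /\
  ((fun n : nat => 1 - Pr (p n) (fun G : bigraph n =>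
      within_factor (2 * Num.sqrt (eps n))
        #|L 1 G :&: N1 n|%:R #|L 1 G :&: N2 n|%:R) : R^o)
    =O_\oo (fun n : nat => (eps n ^+ 3 * n%:R) `^ (- (1 / 6)) : R^o)).
Proof.
move=> p.
pose C : R := 48 * (10 * 100 * 100) ^+ 2 + 12.
pose size n : R := n%:R `^ (2 / 3).
(* A single event implies both claims, so one probability bound serves twice. *)
pose giant n : pred (bigraph n) := has_giant
  (giant_sizes (eps n) ((eps n + eps' n) / (1 + eps n) * n%:R) (size n)) (size n).
have bound : \forall n \near \oo,
    0 <= p n <= 1 /\
    Ex (p n) (fun G : bigraph n => (~~ giant n G)%:R) <=
      C * (eps n ^+ 3 * n%:R) `^ (- (1 / 3)).
  near=> n.
  have n0 : (0 < n)%N by near: n; exact: nbhs_infty_gt.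
  have e0 := eps_gt0 n.
  have es : eps n <= 1 / 50.
    near: n; apply: (cvgr_le 0) => //; lra.
  (* This is the cube of the threshold on [eps * t], as [(eps * t) ^+ 3 = eps ^+ 3 * n]. *)
  have big : (20 * 100) ^+ 3 <= eps n ^+ 3 * n%:R.
    near: n; exact: (cvgryPge _).1.
  pose t : R := n%:R `^ (1 / 3).
  have nR : 0 < n%:R :> R by rewrite ltr0n.
  have t0 : 0 < t by rewrite powR_gt0.
  have tn : t ^+ 3 = n%:R.
    by rewrite -powR_mulrn ?powR_ge0 // -powRrM divfK ?powRr1 ?ltW.
  have t2 : n%:R `^ (2 / 3) = t ^+ 2.
    by rewrite -powR_mulrn ?powR_ge0 // -powRrM; congr powR; field.
  have lamE : eps n ^+ 3 * n%:R = (eps n * t) ^+ 3 by rewrite exprMn tn.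
  have et0 : 0 < eps n * t by rewrite mulr_gt0.
  have et : 20 * 100 <= eps n * t.
    by move: big; rewrite lamE ler_pXn2r ?nnegrE ?mulr_ge0 // ltW.
  have [e'0 dual] := eps'_def n.
  pose N : R := t ^+ 2; pose m := N / (10 * 100).
  have mE : N = 10 * 100 * m by rewrite /m mulrC divfK.
  have pE : p n = (1 + eps n) / n%:R by [].
  have [p0 p1 _ _] := p_facts t0 tn e0 es et e'0 dual pE erefl erefl mE erefl.
  split; first by rewrite p0 ltW.
  have := supercritical_bound t0 tn e0 es et e'0 dual pE erefl erefl mE erefl.
  rewrite -/C /giant /size t2 => /le_trans; apply.
  rewrite ler_wpM2l //; first by rewrite /C; lra.
  rewrite lamE powRN lef_pV2 ?posrE ?powR_gt0 ?exprn_gt0 //.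
  rewrite -powR_mulrn ?(ltW et0) // -powRrM (_ : 3 * (1 / 3) = 1); last by field.
  by rewrite powRr1 ?(ltW et0).
have lam1 : \forall n \near \oo, 1 <= eps n ^+ 3 * n%:R by exact: (cvgryPge _).1.
have giantP n (G : bigraph n) : giant n G ->
    [/\ `| #|L 1 G|%:R - 2 * (eps n + eps' n) / (1 + eps n) * n%:R |
         < 1 / 50 * n%:R `^ (2 / 3), #|L 2 G|%:R <= n%:R `^ (2 / 3) :> R &
      within_factor (2 * Num.sqrt (eps n)) #|L 1 G :&: N1 n|%:R #|L 1 G :&: N2 n|%:R].
  move=> /has_giant_L[|x y /and3P[]|/and3P[h1 h2 h3] h4] //; first exact: powR_ge0.
  have e : 2 * (eps n + eps' n) / (1 + eps n) * n%:R = 2 * ((eps n + eps' n) / (1 + eps n) * n%:R).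
    by rewrite !mulrA.
  by split=> //; rewrite e card_N12.
have PrP n (A : pred (bigraph n)) : 0 <= p n <= 1 ->
    Ex (p n) (fun G : bigraph n => (~~ giant n G)%:R) <=
      C * (eps n ^+ 3 * n%:R) `^ (- (1 / 3)) ->
    (forall G, giant n G -> A G) ->
    0 <= 1 - Pr (p n) A <= C * (eps n ^+ 3 * n%:R) `^ (- (1 / 3)).
  move=> p01 bnd gA; rewrite PrC Ex_ge0 //=; apply: le_trans bnd.
  apply: le_Ex => // G; rewrite ler_nat.
  by case: (boolP (giant n G)) => [/gA ->|_] //; case: (A G).
split; apply: (bigO_of_bound (C := C) lam1); near=> n.
  have [p01 bnd] : 0 <= p n <= 1 /\
    Ex (p n) (fun G : bigraph n => (~~ giant n G)%:R) <=
      C * (eps n ^+ 3 * n%:R) `^ (- (1 / 3)) by near: n; exact: bound.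
  by apply: (PrP _ _ p01 bnd) => G /giantP[h1 h2 _]; rewrite h1 h2.
have [p01 bnd] : 0 <= p n <= 1 /\
  Ex (p n) (fun G : bigraph n => (~~ giant n G)%:R) <=
    C * (eps n ^+ 3 * n%:R) `^ (- (1 / 3)) by near: n; exact: bound.
by apply: (PrP _ _ p01 bnd) => G /giantP[_ _ h3].
Unshelve. all: by end_near.
Qed.
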